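(* The set $\{\mathbf n_\pi:\pi\text{ a set partition of }[n]\text{ all of whose blocks have odd size}\}$ is a basis of $\mathrm{NCSym}_n\cap\mathrm{NC}\Pi_n$ (and hence, over all $n$, of $\mathrm{NCSym}\cap\mathrm{NC}\Pi$).
   Context: Let $\mathbf x_1,\mathbf x_2,\dots$ be noncommuting variables over $\mathbb Q$, $[m]=\{1,\dots,m\}$. A set composition $\phi=\phi_1|\cdots|\phi_\ell$ of $[n]$ is a sequence of disjoint nonempty blocks with union $[n]$, $\ell(\phi)=\ell$; it is odd if all blocks have odd size; $\pi(\phi)$ is the set partition with the same blocks. For $\psi,\phi$ set compositions, $\psi\le\phi$ if each block of $\psi$ is a union of consecutive blocks of $\phi$. $\mathbf M_\phi=\sum\mathbf x_{i_1}\cdots\mathbf x_{i_n}$ over tuples of positive integers with $i_j=i_k$ iff $j,k$ in the same block and $i_j<i_k$ iff the block of $j$ is left of that of $k$. $\mathrm{NCQSym}_n=\mathrm{span}\{\mathbf M_\phi\}$; for a set partition $\pi$, $\mathbf m_\pi=\sum_{\pi(\phi)=\pi}\mathbf M_\phi$ and $\mathrm{NCSym}_n=\mathrm{span}\{\mathbf m_\pi:\pi\text{ set partition of }[n]\}$. Order nonzero integers by $-1\prec1\prec-2\prec2\prec\cdots$. For a poset $P$ on an $n$-set $X$ and bijections $\gamma,\sigma:X\to[n]$, an enriched $(P,\gamma)$-partition is $f:X\to\mathbb Z\setminus\{0\}$ with, for $a\le b$: $f(a)\preceq f(b)$, $f(a)=f(b)>0\Rightarrow\gamma(a)<\gamma(b)$,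 $f(a)=f(b)<0\Rightarrow\gamma(a)>\gamma(b)$; $\mathbf K_{(P,\gamma,\sigma)}=\sum_f\mathbf x_{|f(\sigma^{-1}(1))|}\cdots\mathbf x_{|f(\sigma^{-1}(n))|}$, and $\mathrm{NC}\Pi_n$ is the span of all such with $|X|=n$. For a peak set $B$ (subset of $\{2,\dots,n-1\}$ with no two consecutive integers) and $\sigma\in\mathfrak S_n$, $\mathbf K_{(B,\sigma)}=\mathbf K_{(P,\gamma,\sigma)}$ with $P$ the chain $1<\cdots<n$ and any $\gamma$ with $\{i:\gamma(i-1)<\gamma(i)>\gamma(i+1)\}=B$ (well defined), and $\boldsymbol\eta_{(B,\sigma)}=\sum_{C\subseteq B}(-1)^{|B|-|C|}\mathbf K_{(C,\sigma)}$. With $\mathrm{Odd}(B)=[n-1]\setminus(B\cup(B-1))$, each odd set composition $\phi$ equals $\{\sigma(1),\dots,\sigma(a_1)\}|\{\sigma(a_1+1),\dots,\sigma(a_2)\}|\cdots$ for a unique pair $(B,\sigma)$ with $\mathrm{Odd}(B)=\{a_1<a_2<\cdots\}$ and $\{i:\sigma(i)>\sigma(i+1)\}\subseteq\mathrm{Odd}(B)$; set $\boldsymbol\eta_\phi=\boldsymbol\eta_{(B,\sigma)}$. For a set partition $\pi$ of $[n]$ with all blocks odd, $\mathbf n_\pi=(-1)^{(n-\ell(\pi))/2}\sum_{\phi}\boldsymbol\eta_\phi$, summed over set compositions $\phi$ with $\pi(\phi)=\pi$. *)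

(* Defs.v *)
From HB Require Import structures.
From mathcomp Require Import all_boot all_order all_algebra all_fingroup.
From mathcomp Require Import all_classical.

Set Implicit Arguments.
Unset Strict Implicit.
Unset Printing Implicit Defensive.

Import Order.TTheory GRing.Theory Num.Theory.

Local Open Scope classical_set_scope.
Local Open Scope ring_scope.

Definition lin_span (F : fieldType) (V : lmodType F) (S : set V) : set V :=
  [set v | exists s : seq (F * V),
     (forall p, p \in s -> S p.2) /\ v = \sum_(p <- s) p.1 *: p.2].

Definition lin_indep (F : fieldType) (V : lmodType F) (I : choiceType)
    (D : set I) (b : I -> V) : Prop :=
  forall (s : seq I) (c : I -> F),
    uniq s -> (forall i, i \in s -> D i) ->
    \sum_(i <- s) c i *: b i = 0 ->
    forall i, i \in s -> c i = 0.

(* The family (b i), i in D, is a basis of the subspace W; in particular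
   b is injective on D. *)
Definition is_basis (F : fieldType) (V : lmodType F) (I : choiceType)
    (D : set I) (b : I -> V) (W : set V) : Prop :=
  lin_indep D b /\ lin_span (b @` D) = W.

(* A series maps each word to its coefficient; the word [:: i; j; k] stands for
   x_i x_j x_k.  The variables are x_1, x_2, ...: the letter 0 never occurs in
   the series built below.  rat^o is rat seen as a module over itself, which makes
   series a rational vector space under pointwise operations. *)
Notation series := (seq nat -> rat^o).

(* The formal sum of the words (wd a), a in A; it is used only when every word
   arises from finitely many a in A. *)
Definition formal_sum (T : choiceType) (A : set T) (wd : T -> seq nat) : series :=
  fun w => \sum_(a \in A `&` [set a | wd a = w]) (1 : rat).

(* Throughout, i : 'I_n stands for the element i + 1 of [n] = {1, ..., n}. *)

Definition set_composition n (phi : seq {set 'I_n}) : bool :=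
  uniq phi && finset.partition [set:: phi]%SET [set: 'I_n]%SET.

Definition set_partition n (p : {set {set 'I_n}}) : bool :=
  finset.partition p [set: 'I_n]%SET.

Definition odd_set_partition n (p : {set {set 'I_n}}) : bool :=
  set_partition p && [forall S in p, odd #|S|].

(* The set compositions phi with pi(phi) = p. *)
Definition compositions_over n (p : {set {set 'I_n}}) : set (seq {set 'I_n}) :=
  [set phi | set_composition phi /\ [set:: phi]%SET = p].

Definition block_index n (phi : seq {set 'I_n}) (j : 'I_n) : nat :=
  find (fun S : {set 'I_n} => j \in S) phi.

Definition M n (phi : seq {set 'I_n}) : series :=
  formal_sum
    [set t : {ffun 'I_n -> nat} |
       (forall j, 0 < t j)%N /\
       forall j k,
         (t j = t k <-> block_index phi j = block_index phi k) /\
         ((t j < t k)%N <-> (block_index phi j < block_index phi k)%N)]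
    (fun t => [seq t j | j <- enum 'I_n]).

Definition m n (p : {set {set 'I_n}}) : series :=
  \sum_(phi \in compositions_over p) M phi.

Definition NCSym_ (n : nat) : set series :=
  lin_span [set m p | p in [set p : {set {set 'I_n}} | set_partition p]].

Definition NCSym : set series := lin_span (\bigcup_(n in setT) NCSym_ n).

(* The order -1 < 1 < -2 < 2 < ... on nonzero integers. *)
Definition preceq (x y : int) : bool :=
  (`|x| < `|y|) || ((`|x| == `|y|) && (x <= y)).

(* The conditions are imposed for a < b only: at a = b the last two could never
   hold together with f a != 0. *)
Definition enriched d (X : finPOrderType d) n (gamma : X -> 'I_n)
    (f : {ffun X -> int}) : Prop :=
  (forall a, f a != 0) /\
  forall a b, (a < b)%O ->
    [/\ preceq (f a) (f b),
        f a = f b -> 0 < f a -> (gamma a < gamma b)%N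
      & f a = f b -> f a < 0 -> (gamma b < gamma a)%N].

(* K_(P, gamma, sigma), where the argument sigmaV is the inverse of sigma. *)
Definition K d (X : finPOrderType d) n (gamma : X -> 'I_n) (sigmaV : 'I_n -> X)
    : series :=
  formal_sum [set f | enriched gamma f]
             (fun f => [seq absz (f (sigmaV i)) | i <- enum 'I_n]).

Definition NCPi_ (n : nat) : set series :=
  lin_span [set F | exists d (X : finPOrderType d) (gamma sigma : X -> 'I_n)
                       (sigmaV : 'I_n -> X),
          [/\ bijective gamma, cancel sigma sigmaV, cancel sigmaV sigma
            & F = K gamma sigmaV]].

Definition NCPi : set series := lin_span (\bigcup_(n in setT) NCPi_ n).

Definition peak_set n (B : {set 'I_n}) : bool :=
  [forall i in B, (0 < i)%N && (i.+1 < n)%N] &&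
  [forall i in B, [forall j in B, j != i.+1 :> nat]].

Definition peaks n (gamma : {perm 'I_n}) : {set 'I_n} :=
  [set i : 'I_n | [exists j : 'I_n, exists k : 'I_n,
     [&& i == j.+1 :> nat, k == i.+1 :> nat,
         (gamma j < gamma i)%N & (gamma k < gamma i)%N]]]%SET.

Definition descents n (sigma : {perm 'I_n}) : {set 'I_n} :=
  [set i : 'I_n | [exists j : 'I_n,
     (j == i.+1 :> nat) && (sigma j < sigma i)%N]]%SET.

(* K_(B, sigma): P is the chain 'I_n and gamma is any permutation with peak set
   B, the result being independent of gamma.  Such a gamma exists for every peak
   set B; otherwise the value is 0. *)
Definition K_peak n (B : {set 'I_n}) (sigma : {perm 'I_n}) : series :=
  if [pick gamma : {perm 'I_n} | peaks gamma == B] is Some gamma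
  then K gamma (sigma^-1)%g else 0.

Definition eta_peak n (B : {set 'I_n}) (sigma : {perm 'I_n}) : series :=
  \sum_(C : {set 'I_n} | C \subset B)
     (-1 : rat) ^+ (#|B| - #|C|) *: K_peak C sigma.

Definition Odd n (B : {set 'I_n}) : {set 'I_n} :=
  [set i : 'I_n | [&& (i.+1 < n)%N, i \notin B
                    & [forall j in B, j != i.+1 :> nat]]]%SET.

(* For A = {a_1 < a_2 < ...} included in [n-1], the blocks
   {sigma(1), ..., sigma(a_1)} | {sigma(a_1 + 1), ..., sigma(a_2)} | ...
   The position p lies in the block numbered by the elements of A before p.
   The filter has an effect only for n = 0, where there are no blocks. *)
Definition cut_blocks n (A : {set 'I_n}) (sigma : {perm 'I_n})
    : seq {set 'I_n} :=
  [seq S <- [seq [set sigma p | p : 'I_n & #|[set a in A | (a < p)%N]%SET| == k]%SET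
            | k <- iota 0 #|A|.+1]
  | S != finset.set0].

(* The pair (B, sigma) attached to an odd set composition phi is unique; the
   value 0 is never used for such phi. *)
Definition eta n (phi : seq {set 'I_n}) : series :=
  if [pick Bs : {set 'I_n} * {perm 'I_n} |
        [&& peak_set Bs.1, descents Bs.2 \subset Odd Bs.1
          & cut_blocks (Odd Bs.1) Bs.2 == phi]] is Some Bs
  then eta_peak Bs.1 Bs.2 else 0.

Definition nn n (p : {set {set 'I_n}}) : series :=
  (-1 : rat) ^+ ((n - #|p|)./2) *:
    \sum_(phi \in compositions_over p) eta phi.

(* Main.v *)
(* A homogeneous series of degree n is identified with its coefficients at the words
   t(1)+1, ..., t(n)+1, for functions t on [n].

   Chains: K_(C, sigma) is, up to the factor 2^|im t|, the indicator of the t that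
   increase along sigma and are not flat around any peak in C.  By inclusion-exclusion
   eta_phi is, up to sign and the factor 2^|im t|, the indicator of the t that are
   weakly increasing along phi.  Hence n_pi(t) is 2^|im t| times the number of
   orderings of the blocks of pi along which t is weakly increasing: a number which
   depends only on the kernel of t, and vanishes unless pi refines it.  This gives
   n_pi in NCSym, and triangularity, hence linear independence.

   Spanning: if a fiber T of t is split into T \ R followed by R, in all ways, the
   alternating sum of the coefficients of any K vanishes.  When |T| is even, the terms
   R = 0 and R = T both give the coefficient at t, which is thus determined by those
   at finer t.  So an element of NCPi_n is determined by its coefficients at the t with
   odd fibers; for an element of NCSym_n too, these are matched, by triangularity, by a
   combination of the n_pi. *)
Require Import Defs.
From mathcomp Require Import all_boot all_order all_algebra all_fingroup.
From mathcomp Require Import all_classical.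
From mathcomp Require Import fintype finset zify.

Set Implicit Arguments.
Unset Strict Implicit.
Unset Printing Implicit Defensive.

Import Order.TTheory GRing.Theory Num.Theory.

Local Open Scope ring_scope.

(** * Linear spans *)

Section Span.
Variables (F : fieldType) (V : lmodType F).
Implicit Types (S : set V) (u v : V).

Lemma lin_span_gen S v : S v -> lin_span S v.
Proof.
move=> Sv; exists [:: (1, v)]; split; last by rewrite big_seq1 scale1r.
by move=> p; rewrite inE => /eqP ->.
Qed.

Lemma lin_span0 S : lin_span S 0.
Proof. by exists [::]; split; rewrite ?big_nil. Qed.

Lemma lin_spanD S u v : lin_span S u -> lin_span S v -> lin_span S (u + v).
Proof.
move=> [s [Ss ->]] [r [Sr ->]]; exists (s ++ r); split; last by rewrite big_cat.
by move=> p; rewrite mem_cat => /orP[/Ss|/Sr].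
Qed.

Lemma lin_spanZ S a v : lin_span S v -> lin_span S (a *: v).
Proof.
move=> [s [Ss ->]]; exists [seq (a * p.1, p.2) | p <- s]; split.
  by move=> _ /mapP[p /Ss Sp ->].
by rewrite big_map scaler_sumr; apply: eq_bigr => p _; rewrite scalerA.
Qed.

Lemma lin_span_sum S (I : eqType) (r : seq I) (P : pred I) (f : I -> V) :
  (forall i, i \in r -> P i -> lin_span S (f i)) ->
  lin_span S (\sum_(i <- r | P i) f i).
Proof.
move=> Sf; rewrite big_seq_cond; apply: (big_ind (lin_span S)).
- exact: lin_span0.
- exact: lin_spanD.
- by move=> i /andP[]; apply: Sf.
Qed.

Lemma lin_span_ind S (P : V -> Prop) :
  P 0 -> (forall u v, P u -> P v -> P (u + v)) ->
  (forall a v, P v -> P (a *: v)) -> (forall v, S v -> P v) ->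
  forall v, lin_span S v -> P v.
Proof.
move=> P0 PD PZ PS v [s [Ss ->]]; rewrite big_seq; apply: (big_ind P) => // p.
by move=> /Ss/PS; apply: PZ.
Qed.

Lemma lin_span_sub S T :
  (forall v, S v -> lin_span T v) -> forall v, lin_span S v -> lin_span T v.
Proof.
move=> ST; apply: lin_span_ind => //; first exact: lin_span0.
- exact: lin_spanD.
- by move=> a v; apply: lin_spanZ.
Qed.

End Span.

Lemma seriesD (f g : series) w : (f + g) w = f w + g w. Proof. by []. Qed.

Lemma seriesZ a (f : series) w : (a *: f) w = a * f w. Proof. by []. Qed.

Lemma series_sumE (I : Type) (r : seq I) (P : pred I) (f : I -> series) w :
  (\sum_(i <- r | P i) f i) w = \sum_(i <- r | P i) f i w.
Proof. by rewrite fct_sumE. Qed.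

Lemma formal_sumE (T : choiceType) (A : set T) (wd : T -> seq nat) w (r : seq T) :
  uniq r -> (forall a, A a /\ wd a = w <-> a \in r) ->
  formal_sum A wd w = (size r)%:R.
Proof.
move=> ur rP; rewrite /formal_sum.
rewrite (_ : (A `&` [set a | wd a = w])%classic = [set` r]%classic); last first.
  by apply/seteqP; split => a /= /rP.
by rewrite -fsbig_seq // big_tnth sumr_const card_ord.
Qed.

(** * Coefficients *)

(** The shift by one lets [t] take the value 0 while the letters stay positive. *)
Definition word n (t : 'I_n -> nat) : seq nat := [seq (t j).+1 | j <- enum 'I_n].

Lemma word_inj n (t u : 'I_n -> nat) : word t = word u -> t =1 u.
Proof.
move=> /eq_in_map tu j; have := tu j; rewrite mem_enum => /(_ isT) [].
by [].
Qed.

Lemma size_word n (t : 'I_n -> nat) : size (word t) = n.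
Proof. by rewrite size_map size_enum_ord. Qed.

Lemma map_enum_word n (f : 'I_n -> nat) :
  (forall j, 0 < f j)%N -> [seq f j | j <- enum 'I_n] = word (fun j => (f j).-1).
Proof. by move=> f0; apply: eq_map => j; rewrite prednK. Qed.

(* Neg is the set of elements where an enriched partition with absolute value
   u + 1 is negative; the conditions on f then bear on each pair a < b apart. *)
Definition sign_ok (X : finType) (gamma : X -> nat) (u : X -> nat)
    (Neg : {set X}) (a b : X) : bool :=
  (u a < u b)%N || (u a == u b) &&
  (if a \in Neg then (b \in Neg) ==> (gamma b < gamma a)%N
   else (b \notin Neg) && (gamma a < gamma b)%N).

Definition signs (X : finType) (lt : rel X) (gamma u : X -> nat) : {set {set X}} :=
  [set Neg : {set X} | [forall a, forall b, lt a b ==> sign_ok gamma u Neg a b]].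

Lemma signsP (X : finType) (lt : rel X) (gamma u : X -> nat) (Neg : {set X}) :
  reflect (forall a b, lt a b -> sign_ok gamma u Neg a b)
          (Neg \in signs lt gamma u).
Proof.
rewrite inE; apply: (iffP forallP) => [H a b ab|H a].
  by have /forallP/(_ b)/implyP := H a; apply.
by apply/forallP => b; apply/implyP; apply: H.
Qed.

Section KCoef.
Variables (d : Order.disp_t) (X : finPOrderType d) (n : nat).
Variables (gamma sigma : X -> 'I_n) (sigmaV : 'I_n -> X).
Hypotheses (sigmaK : cancel sigma sigmaV) (sigmaVK : cancel sigmaV sigma).

Definition signed (u : X -> nat) (Neg : {set X}) : {ffun X -> int} :=
  [ffun x => if x \in Neg then - (u x).+1%:Z else (u x).+1%:Z].

Lemma absz_signed u Neg x : absz (signed u Neg x) = (u x).+1.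
Proof. by rewrite ffunE; case: ifP => _; rewrite ?abszN. Qed.

Lemma signed_lt0 u Neg x : (signed u Neg x < 0) = (x \in Neg).
Proof. by rewrite ffunE; case: ifP => _; lia. Qed.

Lemma signed_inj u : injective (signed u).
Proof. by move=> N N' eqN; apply/setP => x; rewrite -!(signed_lt0 u) eqN. Qed.

Lemma enriched_signed u Neg :
  enriched gamma (signed u Neg) <->
  Neg \in signs (fun a b => (a < b)%O) (fun x => gamma x) u.
Proof.
rewrite /enriched; split.
  move=> [_ H]; apply/signsP => a b ab; have := H a b ab.
  rewrite /sign_ok /preceq !ffunE => -[]; case: ifP => _; case: ifP => _ /=; lia.
move=> /signsP H; split.
  by move=> a; rewrite ffunE; case: ifP => _; lia.
move=> a b ab; have := H a b ab.
by rewrite /sign_ok /preceq !ffunE; case: ifP => _; case: ifP => _ /= {}H;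
  split; lia.
Qed.

(** Once its absolute values are prescribed, an enriched partition is determined by the set of
    elements where it is negative. *)
Lemma K_word (t : 'I_n -> nat) :
  K gamma sigmaV (word t) =
  #|signs (fun a b => (a < b)%O) (fun x => gamma x) (t \o sigma)|%:R.
Proof.
set u := t \o sigma; set Ss := signs _ _ _.
rewrite /K (@formal_sumE _ _ _ _ [seq signed u N | N <- enum Ss]).
- by rewrite size_map -cardE.
- by rewrite map_inj_uniq ?enum_uniq //; apply: signed_inj.
move=> f; split.
  move=> [/= fe fw]; have f0 := fe.1.
  have a0 j : (0 < absz (f (sigmaV j)))%N by rewrite absz_gt0.
  have {}fw x : absz (f x) = (u x).+1.
    move: fw; rewrite (map_enum_word a0) => /word_inj/(_ (sigma x)) /=.
    by rewrite sigmaK /u /= => <-; rewrite prednK // absz_gt0.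
  have fE : f = signed u [set x | f x < 0]%SET.
    apply/ffunP => x; rewrite ffunE inE; have := fw x; have := f0 x.
    by case: ifP => ?; lia.
  apply/mapP; exists [set x | f x < 0]%SET => //.
  by rewrite mem_enum; apply/enriched_signed; rewrite -fE.
move=> /mapP[N]; rewrite mem_enum => /enriched_signed Ne ->; split=> //.
by apply: eq_map => j; rewrite absz_signed /u /= sigmaVK.
Qed.

Lemma K_notword w : (forall t : 'I_n -> nat, w <> word t) -> K gamma sigmaV w = 0.
Proof.
move=> wt; rewrite /K (@formal_sumE _ _ _ _ [::]) // => f; split => // -[[f0 _]].
by rewrite map_enum_word => [/esym/wt|j]; rewrite ?absz_gt0.
Qed.

End KCoef.

(** * The splitting relations *)

(* The values of t are doubled, and those of the elements of R raised by one: when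
   R is included in a fiber T of t, this splits the block T into T \ R followed by
   R. *)
Definition split_fun (X : finType) (t : X -> nat) (R : {set X}) : X -> nat :=
  fun j => ((t j).*2 + (j \in R))%N.

Definition fiber (X : finType) (t : X -> nat) v : {set X} := [set j | t j == v].

(** Functions so related have the same fibers in the same order; invariance of the coefficients
    under this relation is quasisymmetry. *)
Definition same_order (X : Type) (t u : X -> nat) : Prop :=
  forall j k, (t j <= t k)%N = (u j <= u k)%N.

Lemma same_order_eq (X : Type) (t u : X -> nat) j k :
  same_order t u -> (t j == t k) = (u j == u k).
Proof. by move=> tu; rewrite !eqn_leq !tu. Qed.

Lemma eq_signs (X : finType) (lt : rel X) (gamma t u : X -> nat) :
  same_order t u -> signs lt gamma t = signs lt gamma u.
Proof.
move=> tu; apply/setP => N; rewrite !inE; apply: eq_forallb => a.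
apply: eq_forallb => b; rewrite /sign_ok (same_order_eq _ _ tu).
by rewrite !ltnNge tu.
Qed.

Definition toggle (X : finType) (x : X) (A : {set X}) : {set X} :=
  [set j | (j \in A) (+) (j == x)].

Lemma toggleK (X : finType) (x : X) : involutive (toggle x).
Proof. by move=> A; apply/setP => j; rewrite !inE addbK. Qed.

Lemma sign_toggle (X : finType) (x : X) (A : {set X}) :
  (-1) ^+ #|toggle x A| = - (-1) ^+ #|A| :> rat.
Proof.
wlog xA : A / x \in A.
  move=> H; have [/H//|xA] := boolP (x \in A).
  have := H (toggle x A); rewrite toggleK => ->; rewrite ?opprK //.
  by rewrite inE eqxx (negbTE xA).
rewrite (_ : toggle x A = A :\ x)%SET; last first.
  apply/setP => j; rewrite !inE; case: eqVneq => [->|]; first by rewrite xA.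
  by rewrite addbF.
by rewrite [in RHS](cardsD1 x) xA exprS mulN1r opprK.
Qed.

(** Toggling [x] is an involution on the subsets of [T] that preserves [h] and reverses the sign. *)
Lemma sum_sign_toggle (X : finType) (T : {set X}) (x : X) (h : {set X} -> rat) :
  x \in T -> (forall R : {set X}, R \subset T -> h (toggle x R) = h R) ->
  \sum_(R : {set X} | R \subset T) (-1) ^+ #|R| * h R = 0.
Proof.
move=> xT hx; set S := LHS; apply/eqP; rewrite -eqNr; apply/eqP.
rewrite {2}/S (reindex_inj (inv_inj (@toggleK _ x))) -sumrN; apply: eq_big => R.
  apply/fintype.subsetP/fintype.subsetP => RT j.
    rewrite inE; have [->//|jx] := eqVneq j x; rewrite addbF; exact: RT.
  have [->//|jx] := eqVneq j x; move=> jR; apply: RT.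
  by rewrite inE (negbTE jx) addbF.
by move=> RT; rewrite hx // sign_toggle mulNr.
Qed.

Section Splitting.
Variables (X : finType) (lt : rel X) (gamma u : X -> nat).
Hypotheses (lt_irr : irreflexive lt) (gamma_inj : injective gamma).

Definition symdiff (A B : {set X}) : {set X} := [set j | (j \in A) (+) (j \in B)].

Lemma symdiffK A : involutive (symdiff A).
Proof. by move=> B; apply/setP => j; rewrite !inE; case: (j \in A); case: (j \in B). Qed.

(* Fix the symmetric difference D of R and of the set of negative elements.  Toggling x
   in R then changes both its sign and its side of the split.  This is harmless for
   the gamma-maximal x in T \ D, where the letter of x moves between 1 and -2, or, if
   T is included in D, for the gamma-minimal x in T, which moves between -1 and 2. *)
Lemma signs_toggle v (D : {set X}) :
  fiber u v != set0 ->
  exists2 x, x \in fiber u v &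
  forall R : {set X}, R \subset fiber u v ->
    symdiff (toggle x R) D \in signs lt gamma (split_fun u (toggle x R)) =
    (symdiff R D \in signs lt gamma (split_fun u R)).
Proof.
set T := fiber u v => T0.
have [x xT xP] : exists2 x, x \in T &
    forall b, b \in T -> b != x ->
      if x \in D then (b \in D) && (gamma x < gamma b)%N
      else (b \notin D) ==> (gamma b < gamma x)%N.
  have [TD|] := eqVneq (T :\: D) set0.
    have /set0Pn[x0 x0T] := T0; case: (arg_minnP gamma x0T) => x xT xmin.
    have inD b : b \in T -> b \in D.
      by move=> bT; apply: contraFT (in_set0 b); rewrite -TD inE bT andbT.
    exists x => // b bT bx; rewrite !inD //= ltn_neqAle xmin // andbT.
    by apply: contraNneq bx => /gamma_inj->.
  move=> /set0Pn[x0 x0T]; case: (arg_maxnP gamma x0T) => x.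
  move=> /setDP[xT /negbTE xD] xmax; exists x => // b bT bx.
  rewrite xD; apply/implyP => bD; have bTD : b \in T :\: D by apply/setDP.
  have /= bmax := xmax b bTD; rewrite ltn_neqAle bmax andbT.
  by apply: contraNneq bx => /gamma_inj->.
exists x => // R RT; rewrite !inE.
apply: eq_forallb => a; apply: eq_forallb => b; case ab: (lt a b) => //=.
have nT j : j \notin T -> (j \in R) = false.
  by move=> jT; apply: contraNF jT => /(fintype.subsetP RT).
have Tv j : (j \in T) = (u j == v) by rewrite inE.
rewrite /sign_ok /split_fun !inE.
(* Only pairs containing [x] are affected. If the other element lies in [T], [xP] applies; otherwise
   the doubled values differ by at least two, and adding one at [x] does not change their order. *)
have [ax|ax] := eqVneq a x.
  subst a; have bx : b != x by apply: contraTneq ab => ->; rewrite lt_irr.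
  rewrite (negbTE bx) addbF.
  have [bT|bT] := boolP (b \in T).
    have := xP b bT bx; move: (bT) (xT); rewrite !Tv => /eqP-> /eqP->.
    by case: (x \in D); case: (b \in D); case: (x \in R); case: (b \in R) => /=; lia.
  rewrite (nT b bT); move: bT (xT); rewrite !Tv => ubv /eqP->.
  by case: (x \in D); case: (b \in D); case: (x \in R) => /=; lia.
rewrite addbF; have [bx|bx] := eqVneq b x; last by rewrite !addbF.
subst b; have [aT|aT] := boolP (a \in T).
  have := xP a aT ax; move: (aT) (xT); rewrite !Tv => /eqP-> /eqP->.
  by case: (x \in D); case: (a \in D); case: (x \in R); case: (a \in R) => /=; lia.
rewrite (nT a aT); move: aT (xT); rewrite !Tv => uav /eqP->.
by case: (x \in D); case: (a \in D); case: (x \in R) => /=; lia.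
Qed.

Lemma signs_splitting v :
  fiber u v != set0 ->
  \sum_(R : {set X} | R \subset fiber u v)
    (-1 : rat) ^+ #|R| * #|signs lt gamma (split_fun u R)|%:R = 0.
Proof.
move=> T0; under eq_bigr => R _.
  rewrite -[#|signs _ _ _|]sum1_card natr_sum big_mkcond /=.
  (* Negative sets are parametrized by their symmetric difference [D] with [R]; for fixed [D] the
     sum over [R] cancels by [signs_toggle]. *)
  rewrite (reindex_inj (inv_inj (@symdiffK R))) /= big_distrr /=; over.
rewrite exchange_big /=; apply: big1 => D _.
have [x xT xP] := signs_toggle D T0.
under eq_bigr => R _ do rewrite -mulrb.
apply: (sum_sign_toggle xT) => R RT.
by congr (_%:R); rewrite -(xP R RT).
Qed.

End Splitting.

(** * The coefficients of enriched P-partition series *)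

(* The properties of the coefficients of the series K of degree n that are used;
   they define a subspace, and the last one makes its elements determined by their
   coefficients at odd set compositions. *)
Definition splits n (G : series) : Prop :=
  [/\ forall w, (forall t : 'I_n -> nat, w <> word t) -> G w = 0,
      forall t u : 'I_n -> nat, same_order t u -> G (word t) = G (word u)
    & forall (t : 'I_n -> nat) v, fiber t v != set0 ->
      \sum_(R : {set 'I_n} | R \subset fiber t v)
         (-1) ^+ #|R| * G (word (split_fun t R)) = 0].

Lemma lin_span_splits n S G :
  (forall F, S F -> splits n F) -> lin_span S G -> splits n G.
Proof.
move=> SP; apply: (lin_span_ind (P := splits n)).
- by split=> // *; apply: big1 => R _; rewrite mulr0.
- move=> E F [G0 G1 G2] [F0 F1 F2]; split=> [w wt|t u tu|t v tv].
  + by rewrite seriesD G0 ?F0 ?addr0.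
  + by rewrite !seriesD (G1 _ _ tu) (F1 _ _ tu).
  + under eq_bigr do rewrite seriesD mulrDr.
    by rewrite big_split /= G2 // F2 // addr0.
- move=> a F [F0 F1 F2]; split=> [w wt|t u tu|t v tv].
  + by rewrite seriesZ F0 ?mulr0.
  + by rewrite !seriesZ (F1 _ _ tu).
  + under eq_bigr do rewrite seriesZ mulrCA.
    by rewrite -mulr_sumr F2 // mulr0.
- exact: SP.
Qed.

Lemma K_splits d (X : finPOrderType d) n (gamma sigma : X -> 'I_n)
    (sigmaV : 'I_n -> X) :
  injective gamma -> cancel sigma sigmaV -> cancel sigmaV sigma ->
  splits n (K gamma sigmaV).
Proof.
move=> gamma_inj sK sVK; split=> [w|t u tu|t v tv].
- exact: K_notword.
- rewrite !(K_word _ sK sVK) (@eq_signs _ _ _ (t \o sigma) (u \o sigma)) //.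
  by move=> j k; apply: tu.
have gI : injective (fun x => gamma x : nat) by move=> x y /val_inj/gamma_inj.
have ltI : irreflexive (fun a b : X => (a < b)%O) by move=> a; rewrite ltxx.
rewrite -[RHS](signs_splitting (u := t \o sigma) (v := v) ltI gI); last first.
  have /set0Pn[j jt] := tv; apply/set0Pn; exists (sigmaV j); rewrite inE /= sVK.
  by move: jt; rewrite inE.
(* Subsets of positions correspond to subsets of the poset through [sigma]. *)
rewrite (reindex (fun R : {set X} => sigmaV @^-1: R)%SET) /=; last first.
  exists (fun R : {set 'I_n} => sigma @^-1: R)%SET => R _;
    apply/setP => j; rewrite !inE ?sK //.
  by rewrite sVK.
apply: eq_big => R.
  apply/fintype.subsetP/fintype.subsetP => RT j.
    by move=> jR; have := RT (sigma j); rewrite !inE sK; apply.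
  by rewrite !inE => /RT; rewrite inE /= sVK.
move=> RT; rewrite (K_word _ sK sVK); congr (_ * _).
  congr (_ ^+ _); apply: on_card_preimset.
  by exists sigma => j _.
congr (#|(_ : {set {set X}})|%:R); apply: eq_signs => j k.
by rewrite /split_fun /= !inE !sK.
Qed.

Lemma NCPi_splits n G : NCPi_ n G -> splits n G.
Proof.
apply: lin_span_splits => F [d [X [gamma [sigma [sigmaV [gb sK sVK ->]]]]]].
exact: K_splits (bij_inj gb) sK sVK.
Qed.

Definition odd_fibers n (t : 'I_n -> nat) : Prop :=
  forall v, fiber t v != set0 -> odd #|fiber t v|.

Lemma splits_eq0 n G :
  splits n G -> (forall t : 'I_n -> nat, odd_fibers t -> G (word t) = 0) ->
  forall w, G w = 0.
Proof.
move=> [G0 G1 G2] Godd w.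
have [[t ->]|wt] := pselect (exists t : 'I_n -> nat, w = word t); last first.
  by apply: G0 => t wt'; apply: wt; exists t.
(* Induction on the number of pairs on which [t] takes equal values: splitting a fiber into two
   nonempty parts lowers it. *)
pose ker (t : 'I_n -> nat) := [set p : 'I_n * 'I_n | t p.1 == t p.2]%SET.
have [k] := ubnP #|ker t|; elim: k t => // k IH t; rewrite ltnS => tk.
have [/Godd//|] := pselect (odd_fibers t).
move=> /existsNP[v /not_implyP[T0 /negP Teven]].
have := G2 t v T0; set T := fiber t v in T0 Teven *.
rewrite (bigD1 set0) ?sub0set //= (bigD1 T) /=; last by rewrite subxx T0.
rewrite big1 => [|R /andP[/andP[RT R0] RnT]]; last first.
  rewrite IH ?mulr0 //; apply: leq_trans tk; apply: proper_card.
  have /properP[_ [y yT yR]] : R \proper T by rewrite properEneq RnT.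
  have /set0Pn[x xR] := R0; apply/properP; split.
    by apply/fintype.subsetP => -[a b]; rewrite !inE /split_fun /=; lia.
  exists (x, y).
    have := fintype.subsetP RT _ xR; move: yT; rewrite !inE /= => /eqP-> /eqP->.
    by [].
  by rewrite !inE /split_fun /= xR (negbTE yR); lia.
(* Since [T] has even size, both extreme terms carry the sign +1. Both split functions have the
   order of [t], so twice the coefficient at [t] is 0. *)
rewrite cards0 expr0 mul1r -signr_odd (negbTE Teven) expr0 mul1r addr0.
rewrite (G1 (split_fun t set0) t) => [|a b]; last first.
  by rewrite /split_fun !inE !addn0 leq_double.
rewrite (G1 (split_fun t T) t) => [|a b]; last first.
  by rewrite /split_fun /T !inE; lia.
by move=> /eqP; rewrite -mulr2n mulrn_eq0 => /eqP.
Qed.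

(** * Chains and peaks *)

(** Counting fibers instead of values makes the dependence on the kernel of [t] alone immediate. *)
Definition nvals n (t : 'I_n -> nat) : nat := #|[set fiber t (t j) | j : 'I_n]|.

Definition mono n (u : 'I_n -> nat) : bool :=
  [forall a : 'I_n, forall b : 'I_n, (a < b)%N ==> (u a <= u b)%N].

(** Equality with the existing neighbors of [b]; an element of a peak set has both. *)
Definition flat n (u : 'I_n -> nat) (b : 'I_n) : bool :=
  [forall j : 'I_n, (j.+1 == b :> nat) || (j == b.+1 :> nat) ==> (u j == u b)].

Lemma monoP n (u : 'I_n -> nat) :
  reflect (forall a b : 'I_n, (a <= b)%N -> (u a <= u b)%N) (mono u).
Proof.
apply: (iffP forallP) => [H a b|H a].
  rewrite leq_eqVlt => /orP[/eqP/val_inj->//|ab].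
  by have /forallP/(_ b)/implyP := H a; apply.
by apply/forallP => b; apply/implyP => /ltnW; apply: H.
Qed.

Section Chain.
Variables (n : nat) (gamma : {perm 'I_n}) (u : 'I_n -> nat).

Let gam (a : 'I_n) : nat := gamma a.
Let lt (a b : 'I_n) : bool := (a < b)%N.

Lemma gam_inj : injective gam.
Proof. by move=> a b /val_inj/perm_inj. Qed.

Lemma signs_not_mono : ~~ mono u -> signs lt gam u = set0.
Proof.
move=> um; apply/setP => N; rewrite in_set0; apply: contraNF um => /signsP sN.
apply/forallP => a; apply/forallP => b; apply/implyP => ab.
by have := sN a b ab; rewrite /sign_ok => /orP[/ltnW|/andP[/eqP->]].
Qed.

(** If [b] is negative it conflicts with its left neighbor, and otherwise with its right
    neighbor. *)
Lemma signs_flat_peak b : b \in peaks gamma -> flat u b -> signs lt gam u = set0.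
Proof.
rewrite inE => /existsP[j /existsP[k /and4P[/eqP bj /eqP kb gjb gkb]]].
move=> /forallP bf; apply/setP => N; rewrite in_set0.
apply: contraTF isT => /signsP sN /=.
have uj : u j = u b by apply/eqP; apply: (implyP (bf j)); rewrite bj eqxx.
have uk : u k = u b by apply/eqP; apply: (implyP (bf k)); rewrite kb eqxx orbT.
have := sN j b; have := sN b k; rewrite /lt /sign_ok uj uk /gam.
by case: (b \in N); case: (j \in N); case: (k \in N) => /=; lia.
Qed.

Hypotheses (umono : mono u) (nflat : forall b, b \in peaks gamma -> ~~ flat u b).

(** By monotonicity [u] is constant from [x] to [z]. The position of this range where [gamma] is
    largest is not an end, so it is a peak around which [u] is flat. *)
Lemma no_interior_max (x y z : 'I_n) :
  (x < y)%N -> (y < z)%N -> u x = u z -> (gam x < gam y)%N -> (gam z < gam y)%N ->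
  False.
Proof.
move=> xy yz uxz gx gz; have /monoP um := umono.
pose P (c : 'I_n) := (x <= c <= z)%N.
have Py : P y by rewrite /P; lia.
case: (arg_maxnP gam Py) => c /andP[xc cz] cmax.
have cy : (gam y <= gam c)%N by apply: cmax.
have xc' : (x < c)%N.
  rewrite ltn_neqAle xc andbT; apply: contraTneq gx => /val_inj xE.
  by rewrite xE -leqNgt.
have cz' : (c < z)%N.
  rewrite ltn_neqAle cz andbT; apply: contraTneq gz => /val_inj zE.
  by rewrite -zE -leqNgt.
have cn : (c.-1 < n)%N by have := ltn_ord c; lia.
have cn' : (c.+1 < n)%N by have := ltn_ord z; lia.
have uc w : P w -> u w = u c.
  move=> /andP[xw wz]; have := um _ _ xw; have := um _ _ wz.
  by have := um _ _ xc; have := um _ _ cz; lia.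
have gc w : P w -> w != c -> (gam w < gam c)%N.
  move=> Pw wc; rewrite ltn_neqAle; have /= -> := cmax w Pw; rewrite andbT.
  by apply: contraNneq wc => /gam_inj->.
have /nflat/negP : c \in peaks gamma.
  rewrite inE; apply/existsP; exists (Ordinal cn); apply/existsP.
  exists (Ordinal cn'); apply/and4P; split => //=; first by lia.
    by apply: (gc (Ordinal cn)); rewrite /P -?val_eqE /=; lia.
  by apply: (gc (Ordinal cn')); rewrite /P -?val_eqE /=; lia.
apply; apply/forallP => w; apply/implyP => wc; apply/eqP/uc.
by rewrite /P; lia.
Qed.

Definition is_min j := [forall k, (u k == u j) ==> (gam j <= gam k)%N].
Definition mins := [set j | is_min j].
(** These are the elements that are forced to be negative. *)
Definition before_min :=
  [set j : 'I_n | [exists k : 'I_n, [&& is_min k, u k == u j & (j < k)%N]]].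

Lemma is_min_uniq j k : is_min j -> is_min k -> u j = u k -> j = k.
Proof.
move=> /forallP/(_ k)/implyP jm /forallP/(_ j)/implyP km ujk.
apply: gam_inj; apply/eqP.
by rewrite eqn_leq jm ?km ?ujk.
Qed.

Lemma exists_min j : exists2 k, is_min k & u k = u j.
Proof.
pose P k := u k == u j; have Pj : P j by apply: eqxx.
case: (arg_minnP gam Pj) => k /eqP uk kmin; exists k => //.
by apply/forallP => l; apply/implyP; rewrite uk; apply: kmin.
Qed.

(** Along each fiber of [u], [gamma] first decreases and then increases. Elements before the minimum
    must be negative, those after it positive, and the sign at the minimum is free. *)
Lemma signs_min N :
  (N \in signs lt gam u) = (before_min \subset N) && (N \subset before_min :|: mins).
Proof.
have /monoP um := umono.
apply/signsP/andP => [sN|[/fintype.subsetP FN /fintype.subsetP NF] a b ab].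
  split; apply/fintype.subsetP => j.
    rewrite inE => /existsP[k /and3P[/forallP/(_ j) kmin /eqP uk jk]].
    have := sN j k jk; rewrite /sign_ok uk eqxx ltnn /=; case: ifP => //.
    by move: kmin; rewrite uk eqxx /=; lia.
  move=> jN; have [k kmin uk] := exists_min j; rewrite !inE.
  have [<-|kj] := eqVneq k j; first by rewrite kmin orbT.
  apply/orP; left; apply/existsP; exists k; rewrite kmin uk eqxx /= ltnNge.
  apply/negP => kj'; have klj : (k < j)%N by rewrite ltn_neqAle kj' andbT.
  have := sN k j klj; move/forallP/(_ j): kmin; rewrite /sign_ok uk eqxx ltnn jN /=.
  by case: ifP => _ //; lia.
rewrite /sign_ok; have := um _ _ (ltnW ab); rewrite leq_eqVlt.
case/orP => [/eqP uab|->//]; rewrite uab eqxx ltnn /=.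
have [k kmin uk] := exists_min b.
have kle c : u c = u b -> (gam k <= gam c)%N.
  by move=> uc; move/forallP/(_ c)/implyP: kmin; apply; rewrite uc uk.
have NbF c : u c = u b -> c \in N -> (c <= k)%N.
  move=> uc /NF; rewrite !inE => /orP[/existsP[l /and3P[lmin /eqP ul cl]]|cmin].
    by rewrite (is_min_uniq kmin lmin) ?uk ?ul ?uc // ltnW.
  by rewrite (is_min_uniq kmin cmin) ?uk ?uc.
have NF' c : u c = u b -> c \notin N -> (k <= c)%N.
  move=> uc cN; rewrite leqNgt; apply: contra cN => ck; apply: FN; rewrite inE.
  by apply/existsP; exists k; rewrite kmin uk uc eqxx.
have gab : gam a != gam b.
  by apply: contraTneq ab => /gam_inj->; rewrite /lt ltnn.
have ka := kle a uab; have kb := kle b erefl.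
case: ifP => [aN|/negbT aN].
  (* If [gamma] increased from [a] to [b], then [b] would be an interior maximum between [a] and the
     minimum [k]. *)
  apply/implyP => bN; have bk := NbF b erefl bN.
  rewrite ltnNge leq_eqVlt (negbTE gab) /=; apply/negP => gab'.
  have kb' : (b < k)%N.
    rewrite ltn_neqAle bk andbT; apply: contraTneq gab' => /val_inj bE.
    by rewrite bE -leqNgt.
  by apply: (no_interior_max ab kb') => //; rewrite ?uk //; lia.
have ka' := NF' a uab aN; apply/andP; split.
  by apply/negP => /(NbF _ erefl); move: ab; rewrite /lt; lia.
(* Symmetrically, [a] would be an interior maximum between [k] and [b]. *)
rewrite ltnNge leq_eqVlt eq_sym (negbTE gab) /=; apply/negP => gab'.
have ka'' : (k < a)%N.
  rewrite ltn_neqAle ka' andbT; apply: contraTneq gab' => /val_inj aE.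
  by rewrite -aE -leqNgt.
by apply: (no_interior_max ka'' ab) => //; lia.
Qed.

Lemma card_mins : #|mins| = nvals u.
Proof.
rewrite /nvals (_ : [set _ | _ in _] = [set fiber u (u j) | j in mins]).
  rewrite card_in_imset // => j k; rewrite !inE => jm km /setP/(_ j).
  by rewrite !inE eqxx => /esym/eqP ujk; apply: is_min_uniq.
apply/setP => S; apply/imsetP/imsetP => -[j jm ->]; last by exists j.
by have [k km uk] := exists_min j; exists k; rewrite ?inE ?uk.
Qed.

(** Adding [before_min] is a bijection from the subsets of [mins] to the admissible sign sets: one
    free sign per fiber. *)
Lemma card_signs_noflat : #|signs lt gam u| = (2 ^ nvals u)%N.
Proof.
rewrite -card_mins -card_powerset.
have FM j : j \in before_min -> j \in mins -> False.
  rewrite !inE => /existsP[k /and3P[km /eqP uk jk]] jm.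
  by move: jk; rewrite (is_min_uniq km jm uk) ltnn.
rewrite -(card_in_imset (f := fun A => before_min :|: A)); last first.
  move=> A B; rewrite !inE => /fintype.subsetP AM /fintype.subsetP BM /setP AB.
  apply/setP => j; have := AB j; rewrite !in_setU.
  case jF: (j \in before_min) => //= _.
  by apply/idP/idP => [/AM|/BM] /(FM j jF).
apply: eq_card => N; rewrite signs_min.
apply/andP/imsetP => [[FN NF]|[A AM ->]].
  exists (N :\: before_min); first by rewrite powersetE subDset.
  apply/setP => j; rewrite in_setU in_setD.
  by case jF: (j \in before_min) => //=; apply: (fintype.subsetP FN).
by rewrite subsetUl setUS // -powersetE.
Qed.

End Chain.

Lemma peak_set_sub n (B C : {set 'I_n}) : C \subset B -> peak_set B -> peak_set C.
Proof.
move=> /fintype.subsetP CB /andP[/forall_inP B1 /forall_inP B2]; apply/andP; split.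
  by apply/forall_inP => i /CB/B1.
apply/forall_inP => i /CB/B2/forall_inP Bi; apply/forall_inP => j /CB; exact: Bi.
Qed.

(** The keys are standardized: [i] is sent to the number of elements with a smaller key. *)
Lemma exists_ranking n (key : 'I_n -> nat) : injective key ->
  exists g : {perm 'I_n}, forall i j, (g i < g j)%N = (key i < key j)%N.
Proof.
move=> key_inj; pose below i := [set j | key j < key i]%N.
have below_lt i : (#|below i| < n)%N.
  rewrite -[X in (_ < X)%N]card_ord -cardsT; apply: proper_card.
  by apply/properP; split; [exact: subsetT | exists i; rewrite ?inE ?ltnn].
pose g i : 'I_n := Ordinal (below_lt i).
have g_lt i j : (key i < key j)%N -> (g i < g j)%N.
  move=> ij; apply: proper_card; apply/properP; split.
    by apply/fintype.subsetP => k; rewrite !inE => /ltn_trans; apply.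
  by exists i; rewrite !inE ?ltnn.
have g_inj : injective g.
  move=> i j gij; apply: key_inj; apply/eqP; rewrite eqn_leq.
  by apply/andP; split; rewrite leqNgt; apply/negP => /g_lt; rewrite gij ltnn.
exists (perm g_inj) => i j; rewrite !permE; apply/idP/idP; last exact: g_lt.
apply: contraTT; rewrite -!leqNgt leq_eqVlt => /orP[/eqP/key_inj->//|].
by move/g_lt/ltnW.
Qed.

(* Adding n to the values at B in the identity makes B the set of peaks. *)
Lemma exists_peaks n (B : {set 'I_n}) :
  peak_set B -> exists gamma : {perm 'I_n}, peaks gamma = B.
Proof.
move=> /andP[/forall_inP B1 /forall_inP B2].
pose key (i : 'I_n) := ((if i \in B then n else 0) + i)%N.
have key_inj : injective key.
  move=> i j; rewrite /key; have := ltn_ord i; have := ltn_ord j => ? ? ij.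
  by apply: val_inj => /=; move: ij; case: ifP => _; case: ifP => _; lia.
have [g gE] := exists_ranking key_inj.
exists g; apply/setP => i; rewrite inE.
apply/existsP/idP => [[j /existsP[k /and4P[/eqP ij /eqP ki _]]]|iB].
  rewrite gE; apply: contraTT => iB; rewrite -leqNgt.
  by rewrite /key (negbTE iB); case: ifP => _; lia.
have /andP[i0 i1] := B1 i iB; have j1 : (i.-1 < n)%N by lia.
exists (Ordinal j1); apply/existsP; exists (Ordinal i1).
rewrite !gE eqxx /= prednK // eqxx /= /key iB; apply/andP; split.
  case: ifP => [jB|_ /=]; last by lia.
  by have /forall_inP/(_ i iB)/eqP := B2 _ jB; rewrite /= prednK.
case: ifP => [kB|_ /=]; last by have := ltn_ord i; lia.
by have /forall_inP/(_ _ kB)/eqP := B2 _ iB.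
Qed.

(** * Coefficients of the chain series and of their alternating sums *)

Lemma nvals_comp n (sigma : {perm 'I_n}) (t : 'I_n -> nat) :
  nvals (t \o sigma) = nvals t.
Proof.
rewrite /nvals -[RHS](card_imset _ (f := fun S : {set 'I_n} => sigma @^-1: S)).
  apply: eq_card => S; apply/imsetP/imsetP => [[j _ ->]|[_ /imsetP[j _ ->] ->]].
    exists (fiber t (t (sigma j))); first exact: imset_f.
    by apply/setP => k; rewrite !inE.
  exists ((sigma^-1)%g j) => //; apply/setP => k.
  by rewrite !inE /= permKV.
move=> A B /setP AB; apply/setP => j; have := AB ((sigma^-1)%g j).
by rewrite !inE permKV.
Qed.

Lemma K_peakE n (C : {set 'I_n}) (sigma : {perm 'I_n}) : peak_set C ->
  exists2 gamma : {perm 'I_n}, peaks gamma = C &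
    K_peak C sigma = K gamma (sigma^-1)%g.
Proof.
move=> /exists_peaks[gamma0 gE]; rewrite /K_peak; case: pickP => [gamma /eqP g|].
  by exists gamma.
by move=> /(_ gamma0); rewrite gE eqxx.
Qed.

Lemma K_peak_word n (C : {set 'I_n}) (sigma : {perm 'I_n}) (t : 'I_n -> nat) :
  peak_set C ->
  K_peak C sigma (word t) =
  (mono (t \o sigma) && [forall b in C, ~~ flat (t \o sigma) b])%:R
    * (2 ^ nvals t)%:R.
Proof.
move=> /(K_peakE sigma)[gamma gC ->].
rewrite (K_word _ (permK sigma) (permKV sigma)) -natrM; congr (_%:R).
set u := t \o sigma; rewrite -(nvals_comp sigma t) -/u.
set Ss := signs _ _ _.
have -> : Ss = signs (fun a b : 'I_n => (a < b)%N) (fun x => gamma x) u.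
  by apply: eq_finset => N; apply: eq_forallb => a; apply: eq_forallb => b.
have [um|um] := boolP (mono u); last by rewrite signs_not_mono // cards0.
have [nf|] := boolP [forall b in C, ~~ flat u b].
  rewrite mul1n card_signs_noflat // => b; rewrite gC.
  exact: (forall_inP nf).
rewrite negb_forall_in => /exists_inP[b bC /negPn bf].
by rewrite (signs_flat_peak (b := b)) ?gC // cards0.
Qed.

Lemma eta_peak_word n (B : {set 'I_n}) (sigma : {perm 'I_n}) (t : 'I_n -> nat) :
  peak_set B ->
  eta_peak B sigma (word t) = (-1) ^+ #|B| *
    (mono (t \o sigma) && [forall b in B, flat (t \o sigma) b])%:R
    * (2 ^ nvals t)%:R.
Proof.
move=> Bp; rewrite /eta_peak series_sumE; set u := t \o sigma.
under eq_bigr => C CB.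
  rewrite seriesZ K_peak_word ?(peak_set_sub CB) // -/u mulrA; over.
rewrite -mulr_suml; congr (_ * _); have [um|um] /= := boolP (mono u); last first.
  by rewrite mulr0 big1 // => C _; rewrite mulr0.
(* [G] collects the obstructions to flatness. The subsets of [B] that contribute are the subsets of
   [G], and their alternating sum vanishes unless [G] is empty. *)
pose G := [set b in B | ~~ flat u b].
transitivity ((-1) ^+ #|B| *
    \sum_(C : {set 'I_n} | C \subset G) (-1 : rat) ^+ #|C| * 1).
  rewrite big_distrr big_mkcond /= [RHS]big_mkcond /=; apply: eq_bigr => C _.
  have -> : (C \subset G) = (C \subset B) && [forall b in C, ~~ flat u b].
    apply/fintype.subsetP/andP => [CG|[/fintype.subsetP CB /forall_inP Cf] b bC].
      split; first by apply/fintype.subsetP => b /CG; rewrite inE => /andP[].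
      by apply/forall_inP => b /CG; rewrite inE => /andP[].
    by rewrite inE CB // Cf.
  case: ifP => //= CB; have CleB := subset_leq_card CB.
  case: ifP => _; last by rewrite mulr0.
  rewrite !mulr1 -[in RHS](subnK CleB) exprD -mulrA -exprD addnn.
  by rewrite -[X in _ * X]signr_odd odd_double mulr1.
congr (_ * _); have [Bf|] := boolP [forall b in B, flat u b].
  have -> : G = set0.
    apply/setP => b; rewrite !inE; apply/negP => /andP[bB].
    by rewrite (forall_inP Bf).
  under eq_bigl do rewrite subset0.
  by rewrite big_pred1_eq cards0 mulr1.
rewrite negb_forall_in => /exists_inP[b bB bf].
by apply: (sum_sign_toggle (x := b)) => //; rewrite inE bB.
Qed.

Lemma K_peak_NCPi n (C : {set 'I_n}) (sigma : {perm 'I_n}) :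
  peak_set C -> NCPi_ n (K_peak C sigma).
Proof.
move=> /(K_peakE sigma)[gamma _ ->]; apply: lin_span_gen.
exists _, 'I_n, gamma, sigma, (sigma^-1)%g; split => //.
- by exists (gamma^-1)%g; [apply: permK | apply: permKV].
- exact: permK.
- exact: permKV.
Qed.

Lemma eta_peak_NCPi n (B : {set 'I_n}) (sigma : {perm 'I_n}) :
  peak_set B -> NCPi_ n (eta_peak B sigma).
Proof.
move=> Bp; apply: lin_span_sum => C _ CB; apply: lin_spanZ.
exact: K_peak_NCPi (peak_set_sub CB Bp).
Qed.

(** * Set compositions *)

Section SetComposition.
Variables (n : nat) (phi : seq {set 'I_n}).
Hypothesis phi_sc : set_composition phi.

Lemma sc_uniq : uniq phi. Proof. by case/andP: phi_sc. Qed.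

Lemma sc_neq0 S : S \in phi -> S != set0.
Proof.
move=> Sphi; have /andP[_ /and3P[_ _]] := phi_sc; apply: contraNneq => <-.
by rewrite inE.
Qed.

Lemma sc_has (j : 'I_n) : has (fun S : {set 'I_n} => j \in S) phi.
Proof.
have /andP[_ /and3P[/eqP cov _ _]] := phi_sc.
have : j \in cover [set:: phi] by rewrite cov inE.
by move=> /bigcupP[S]; rewrite inE => Sphi jS; apply/hasP; exists S.
Qed.

Lemma block_index_lt (j : 'I_n) : (block_index phi j < size phi)%N.
Proof. by rewrite -has_find sc_has. Qed.

Lemma mem_block (j : 'I_n) : j \in nth set0 phi (block_index phi j).
Proof. exact: (nth_find set0 (sc_has j)). Qed.

Lemma block_index_eq k (j : 'I_n) :
  (k < size phi)%N -> (j \in nth set0 phi k) = (block_index phi j == k).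
Proof.
move=> kphi; apply/idP/eqP => [jk|<-]; last exact: mem_block.
have /andP[phi_uniq /and3P[_ /trivIsetP triv _]] := phi_sc.
apply/eqP; rewrite -(nth_uniq set0 _ kphi phi_uniq) ?block_index_lt //.
apply/negPn/negP => neq.
have := triv (nth set0 phi (block_index phi j)) (nth set0 phi k).
rewrite !inE !mem_nth ?block_index_lt // => /(_ isT isT neq).
move=> /pred0P/(_ j) /=.
by rewrite mem_block jk.
Qed.

Lemma exists_block_index k :
  (k < size phi)%N -> exists j : 'I_n, block_index phi j = k.
Proof.
move=> kphi; have /set0Pn[j] := sc_neq0 (mem_nth set0 kphi).
by rewrite block_index_eq // => /eqP <-; exists j.
Qed.

End SetComposition.

(** The number of cuts before position [p], which is the index of the block containing it in
    [cut_blocks]. Taking [p] in nat allows [p = n]. *)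
Definition rank n (A : {set 'I_n}) (p : nat) : nat := #|[set a in A | (a < p)%N]|.

Lemma leq_rank n (A : {set 'I_n}) p q : (p <= q)%N -> (rank A p <= rank A q)%N.
Proof.
move=> pq; apply: subset_leq_card; apply/fintype.subsetP => a.
by rewrite !inE => /andP[->] /= /leq_trans; apply.
Qed.

Lemma rankS n (A : {set 'I_n}) (p : 'I_n) : rank A p.+1 = (rank A p + (p \in A))%N.
Proof.
rewrite addnC /rank [LHS](cardsD1 p) inE ltnSn andbT; congr (_ + _)%N.
apply: eq_card => a; rewrite !inE -val_eqE /=.
by case: (a \in A); rewrite ?andbF //=; lia.
Qed.

Lemma rank0 n (A : {set 'I_n}) : rank A 0 = 0%N.
Proof. by apply/eqP; rewrite cards_eq0; apply/eqP/setP => a; rewrite !inE andbF. Qed.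

Lemma rank_ord n (A : {set 'I_n}) : rank A n = #|A|.
Proof. by apply: eq_card => a; rewrite inE ltn_ord andbT. Qed.

(** Discrete intermediate values: [rank] grows from 0 by steps of at most one, and it has reached
    [#|A|] at the last position, which is not a cut. *)
Lemma exists_rank n (A : {set 'I_n.+1}) k :
  ord_max \notin A -> (k <= #|A|)%N -> exists p : 'I_n.+1, rank A p = k.
Proof.
move=> nA; rewrite -rank_ord [rank A _](rankS A (@ord_max n)) (negbTE nA) addn0 => kA.
have ex : exists p, (k <= rank A p)%N by exists n.
have pn : (ex_minn ex < n.+1)%N by case: ex_minnP => p _; apply.
exists (Ordinal pn) => /=; move: pn; case: ex_minnP => -[|p] kp pmin pn.
  by move: kp; rewrite rank0; lia.
have kp' : ~~ (k <= rank A p)%N by apply/negP => /pmin; rewrite ltnn.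
have /= pS := rankS A (Ordinal (ltnW pn)).
by move: kp kp'; rewrite pS; case: (_ \in A) => /=; lia.
Qed.

(** * The blocks cut out of a permutation *)

Section CutBlocks.
Variables (n : nat) (A : {set 'I_n.+1}) (sigma : {perm 'I_n.+1}).
Hypothesis nA : ord_max \notin A.

(** By [exists_rank] every block is nonempty, so the filter removes nothing. *)
Lemma cut_blocksE :
  cut_blocks A sigma = [seq [set sigma p | p : 'I_n.+1 & rank A p == k] | k <- iota 0 #|A|.+1].
Proof.
apply/all_filterP/allP => S /mapP[k]; rewrite mem_iota ltnS => kA ->.
have [p pk] := exists_rank nA kA; apply/set0Pn; exists (sigma p).
by apply: imset_f; rewrite inE; apply/eqP.
Qed.

Lemma size_cut_blocks : size (cut_blocks A sigma) = #|A|.+1.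
Proof. by rewrite cut_blocksE size_map size_iota. Qed.

Lemma block_index_cut p : block_index (cut_blocks A sigma) (sigma p) = rank A p.
Proof.
have rA : (rank A p < #|A|.+1)%N by rewrite ltnS -rank_ord leq_rank // ltnW.
rewrite cut_blocksE /block_index find_map.
rewrite (@eq_find _ _ (pred1 (rank A p))) => [|k] /=; last first.
  apply/imsetP/eqP => [[q]|->]; last by exists p; rewrite ?inE.
  by rewrite inE => /eqP <- /perm_inj->.
by rewrite -[RHS](index_uniq 0%N (i := rank A p) (s := iota 0 #|A|.+1))
  ?size_iota ?iota_uniq // nth_iota.
Qed.

End CutBlocks.

Lemma OddP n (B : {set 'I_n}) (i : 'I_n) :
  reflect [/\ (i.+1 < n)%N, i \notin B & forall j, j \in B -> j <> i.+1 :> nat]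
          (i \in Odd B).
Proof.
rewrite inE; apply: (iffP and3P) => -[H1 H2 H3]; split=> //.
  by move=> j jB; apply/eqP/(forall_inP H3).
by apply/forall_inP => j jB; apply/eqP/H3.
Qed.

(** The positions are partitioned into [Odd B], [B], B - 1 and the last position; the map [p] below
    sends [B] onto B - 1. *)
Lemma card_Odd n (B : {set 'I_n.+1}) : peak_set B -> (#|Odd B| + #|B|.*2 = n)%N.
Proof.
move=> /andP[/forall_inP B1 /forall_inP B2].
pose p (j : 'I_n.+1) : 'I_n.+1 := inord j.-1.
have pE j : p j = j.-1 :> nat by rewrite inordK //; have := ltn_ord j; lia.
have pB : #|p @: B| = #|B|.
  apply: card_in_imset => i j /B1/andP[i0 _] /B1/andP[j0 _] pij.
  by apply: val_inj => /=; have := pE i; have := pE j; rewrite pij; lia.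
have dis : B :&: p @: B = set0.
  apply/setP => j; rewrite !inE; apply/negP => /andP[jB /imsetP[i iB ji]].
  have /forall_inP/(_ i iB)/eqP := B2 j jB; have /andP[] := B1 i iB.
  by have -> : j = i.-1 :> nat; [rewrite ji; apply: pE|lia].
have OE : Odd B = ~: (ord_max |: (B :|: p @: B)).
  apply/setP => i; rewrite !in_setC !in_setU in_set1.
  apply/OddP/norP => [[i1 iB ni]|[im /norP[iB ip]]].
    split; first by rewrite -val_eqE /=; lia.
    rewrite (negbTE iB) /=; apply/imsetP => -[j jB ij]; apply: (ni j jB).
    have /andP[] := B1 j jB.
    by have -> : i = j.-1 :> nat; [rewrite ij; apply: pE|lia].
  split => //; first by move: im; have := ltn_ord i; rewrite -val_eqE /=; lia.
  move=> j jB ji; move/negP: ip; apply; apply/imsetP; exists j => //.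
  by apply: val_inj; rewrite /= pE ji.
have mB : ord_max \notin B :|: p @: B.
  rewrite !inE; apply/norP; split.
    by apply/negP => /B1; rewrite ltnn andbF.
  apply/imsetP => -[j jB /(congr1 val)] /=; rewrite [RHS]pE.
  by have := ltn_ord j; have /andP[] := B1 j jB; lia.
have := cardsC (ord_max |: (B :|: p @: B)); rewrite -OE card_ord cardsU1 mB cardsU.
rewrite dis cards0 pB subn0 /=; move: #|Odd B| #|B| => a b; lia.
Qed.

(** Weak increase along [phi]. Equal indices can be compared both ways, so [t] is also constant on
    each block. *)
Definition compat n (phi : seq {set 'I_n}) (t : 'I_n -> nat) : bool :=
  [forall j, forall k,
    (block_index phi j <= block_index phi k)%N ==> (t j <= t k)%N].

Lemma compatP n (phi : seq {set 'I_n}) (t : 'I_n -> nat) :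
  reflect (forall j k, (block_index phi j <= block_index phi k)%N -> (t j <= t k)%N)
          (compat phi t).
Proof.
apply: (iffP forallP) => [H j k|H j].
  by have /forallP/(_ k)/implyP := H j.
by apply/forallP => k; apply/implyP/H.
Qed.

(** Consecutive positions i, i + 1 share a block exactly when i or i + 1 is in [B]; constancy on the
    blocks therefore amounts to flatness around the elements of [B]. *)
Lemma compat_cut n (B : {set 'I_n.+1}) (sigma : {perm 'I_n.+1}) (t : 'I_n.+1 -> nat) :
  compat (cut_blocks (Odd B) sigma) t =
  mono (t \o sigma) && [forall b in B, flat (t \o sigma) b].
Proof.
have nO : ord_max \notin Odd B by apply/OddP => -[]; rewrite ltnn.
set u := t \o sigma.
have step (i j : 'I_n.+1) : j = i.+1 :> nat ->
    rank (Odd B) j = (rank (Odd B) i + (i \in Odd B))%N.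
  by move=> ->; rewrite rankS.
apply/compatP/andP => [H|[/monoP um /forall_inP uf] j k].
  have {}H (p q : 'I_n.+1) : (rank (Odd B) p <= rank (Odd B) q)%N -> (u p <= u q)%N.
    by move=> pq; apply: H; rewrite !block_index_cut.
  split; first by apply/monoP => p q pq; apply/H/leq_rank.
  apply/forall_inP => b bB; apply/forallP => j; apply/implyP => jb.
  suff /eqP E : rank (Odd B) j == rank (Odd B) b.
    by rewrite eqn_leq !H ?E.
  case/orP: jb => /eqP jb.
    rewrite (step j b) //; case: OddP; rewrite ?addn0 // => -[_ _ /(_ b bB)].
    by rewrite jb.
  by rewrite (step b j) //; case: OddP; rewrite ?addn0 // => -[_]; rewrite bB.
rewrite -(permKV sigma j) -(permKV sigma k) !block_index_cut //.
move: ((sigma^-1)%g j) ((sigma^-1)%g k) => p q; rewrite -![t (sigma _)]/(u _) => pq.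
have [/um //|qp] := leqP p q.
(* When [q < p] the two ranks are equal; [u] is then constant from [q] to [p], by induction on the
   distance. *)
have const : forall m (i j : 'I_n.+1), j = (i + m)%N :> nat ->
    rank (Odd B) i = rank (Odd B) j -> u i = u j.
  elim=> [|m IH] i l; first by rewrite addn0 => /val_inj->.
  move=> li ril; have i1 : (i.+1 < n.+1)%N by have := ltn_ord l; lia.
  have r1 := step i (Ordinal i1) erefl.
  have r2 : (rank (Odd B) (Ordinal i1) <= rank (Odd B) l)%N.
    by apply: leq_rank => /=; lia.
  have iO : i \notin Odd B by apply/negP => iO; move: r1 r2; rewrite iO ril; lia.
  have -> : u i = u (Ordinal i1).
    have [iB|iB] := boolP (i \in B).
      have /forallP/(_ (Ordinal i1)) := uf i iB.
      by rewrite /= eqxx orbT => /eqP.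
    have [iB1|iB1] := boolP (Ordinal i1 \in B).
      by have /forallP/(_ i) := uf _ iB1; rewrite /= eqxx => /eqP.
    case/OddP: iO; split=> // l' lB l'i; move/negP: iB1; apply.
    by rewrite (_ : Ordinal i1 = l') //; apply: val_inj.
  apply: IH => /=; first by lia.
  by move: r1; rewrite (negbTE iO) ril addn0.
rewrite (const (p - q)%N q p) //; first by rewrite subnKC // ltnW.
by apply/eqP; rewrite eqn_leq pq leq_rank // ltnW.
Qed.

Lemma eta_peak_cut n (B : {set 'I_n}) (sigma : {perm 'I_n}) (t : 'I_n -> nat) :
  peak_set B ->
  let phi := cut_blocks (Odd B) sigma in
  eta_peak B sigma (word t) =
    (-1) ^+ (n - size phi)./2 * (compat phi t)%:R * (2 ^ nvals t)%:R.
Proof.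
move=> Bp phi; rewrite eta_peak_word //; congr (_ * _).
case: n => [|n] in B sigma t Bp phi *.
  have B0 : #|B| = 0%N by apply/eqP; rewrite cards_eq0; apply/eqP/setP => -[].
  rewrite B0; congr (_ * (nat_of_bool _)%:R).
  have -> : compat phi t by apply/compatP => -[].
  by apply/andP; split; [apply/monoP => -[]|apply/forallP => -[]].
rewrite /phi compat_cut; congr (_ ^+ _ * _).
rewrite size_cut_blocks; last by apply/OddP => -[]; rewrite ltnn.
(* There are [#|Odd B|.+1] blocks for [n.+1] positions, and the difference is twice [#|B|] by
   [card_Odd]. *)
by rewrite subSS -[X in (X - _)%N](card_Odd Bp) addKn doubleK.
Qed.

(** * The peak set and the permutation attached to an odd set composition *)

Section OddComposition.
Variables (n : nat) (phi : seq {set 'I_n.+1}).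
Hypotheses (phi_sc : set_composition phi) (phi_odd : forall S, S \in phi -> odd #|S|).

(** Lexicographic order: sorting by this key lists the blocks one after the other, each in
    increasing order. *)
Let key (j : 'I_n.+1) : nat := (block_index phi j * n.+1 + j)%N.

Lemma key_inj : injective key.
Proof.
move=> i j /(congr1 (fun k => k %% n.+1)%N).
by rewrite !modnMDl !modn_small // => /val_inj.
Qed.

Lemma key_block (i j : 'I_n.+1) :
  (block_index phi i < block_index phi j)%N -> (key i < key j)%N.
Proof. by rewrite /key => ij; have := ltn_ord i; nia. Qed.

Variable sigma : {perm 'I_n.+1}.
Hypothesis sigma_key : forall p q : 'I_n.+1, (p < q)%N = (key (sigma p) < key (sigma q))%N.

Let b (p : 'I_n.+1) : nat := block_index phi (sigma p).

Lemma sorted_mono (p q : 'I_n.+1) : (p <= q)%N -> (b p <= b q)%N.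
Proof.
rewrite leq_eqVlt => /orP[/eqP/val_inj->//|]; rewrite sigma_key.
by apply: contraTT; rewrite -!ltnNge => /key_block/ltnW.
Qed.

Lemma sorted_hit k : (k < size phi)%N -> exists p, b p = k.
Proof.
move=> /(exists_block_index phi_sc)[j jk].
by exists ((sigma^-1)%g j); rewrite /b permKV.
Qed.

(** Blocks are nonempty, so a skipped index would be attained strictly between two consecutive
    positions. *)
Lemma sorted_step (p q : 'I_n.+1) : q = p.+1 :> nat -> (b q <= (b p).+1)%N.
Proof.
move=> qp; rewrite leqNgt; apply/negP => bpq.
have [r rb] : exists r, b r = (b p).+1.
  by apply: sorted_hit; apply: ltn_trans bpq _; apply: block_index_lt.
have pr : (p < r)%N by rewrite ltnNge; apply/negP => /sorted_mono; lia.
have rq : (r < q)%N by rewrite ltnNge; apply/negP => /sorted_mono; lia.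
by lia.
Qed.

Lemma sorted0 : b ord0 = 0%N.
Proof.
have [r rb] : exists r, b r = 0%N.
  apply: sorted_hit; have := block_index_lt phi_sc ord0; exact: leq_ltn_trans.
by apply/eqP; rewrite -leqn0 -rb; apply: sorted_mono.
Qed.

Lemma sorted_last : (b ord_max).+1 = size phi.
Proof.
apply/eqP; rewrite eqn_leq block_index_lt //=.
have [r rb] : exists r, b r = (size phi).-1.
  by apply: sorted_hit; have := block_index_lt phi_sc ord0; lia.
have := @sorted_mono r ord_max; rewrite rb /= => /(_ (leq_ord r)); lia.
Qed.

(** The place of [p] within its block, counted from 0. *)
Let offset (p : 'I_n.+1) : nat := #|[set q : 'I_n.+1 | (q < p)%N && (b q == b p)]|.

Lemma offset_same (p q : 'I_n.+1) : q = p.+1 :> nat -> b q = b p -> offset q = (offset p).+1.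
Proof.
move=> qp bqp; rewrite /offset (cardsD1 p) inE qp ltnSn bqp eqxx /= add1n.
congr _.+1; apply: eq_card => r; rewrite !inE ?qp ?bqp -val_eqE /=.
by case: (b r == b p); rewrite ?andbF // !andbT; lia.
Qed.

Lemma offset_new (p q : 'I_n.+1) : q = p.+1 :> nat -> b q <> b p -> offset q = 0%N.
Proof.
move=> qp bqp; apply/eqP; rewrite cards_eq0; apply/eqP/setP => r; rewrite !inE.
apply/negP => /andP[rq /eqP br]; apply: bqp; apply/eqP.
rewrite eqn_leq -{1}br !sorted_mono //; lia.
Qed.

(* Such a p is the last position of its block, whose size is offset p + 1. *)
Lemma offset_last (p : 'I_n.+1) :
  (forall q : 'I_n.+1, (p < q)%N -> b q <> b p) -> ~~ odd (offset p).
Proof.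
move=> plast; have bp : (b p < size phi)%N by apply: block_index_lt.
have := phi_odd (mem_nth set0 bp).
rewrite (_ : nth set0 phi (b p) = sigma @: [set q | b q == b p]); last first.
  apply/setP => j; rewrite (block_index_eq phi_sc) //.
  apply/eqP/imsetP => [jp|[q]]; last by rewrite inE => /eqP <- ->.
  by exists ((sigma^-1)%g j); rewrite ?inE /b permKV ?jp.
rewrite card_imset; last exact: perm_inj.
rewrite (cardsD1 p) inE eqxx oddD addTb; set D := (X in odd X); suff -> : D = offset p by [].
apply: eq_card => q; rewrite !inE -val_eqE /=.
have [/eqP bq|] := boolP (b q == b p); rewrite ?andbF // !andbT.
by have [//|pq|//] := ltngtP q p; case: (plast q pq).
Qed.

(** This is the peak set B: the second, fourth, ... positions of each block. As the blocks have odd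
    size, B and B - 1 together cover each block except its last position. *)
Definition odd_offsets : {set 'I_n.+1} := [set p | odd (offset p)].

Lemma offset_cut (p q : 'I_n.+1) : q = p.+1 :> nat -> b q <> b p -> ~~ odd (offset p).
Proof.
move=> qp bqp; apply: offset_last => r pr br; apply: bqp; apply/eqP.
by rewrite eqn_leq -{1}br !sorted_mono //; lia.
Qed.

(** Parity alternates within a block, and every block begins and ends with an even offset. *)
Lemma peak_odd_offsets : peak_set odd_offsets.
Proof.
apply/andP; split; apply/forall_inP => i; rewrite inE => io.
  apply/andP; split.
    rewrite lt0n; apply: contraTneq io => i0; rewrite /offset.
    rewrite (_ : [set q | _] = set0) ?cards0 //.
    by apply/setP => q; rewrite !inE i0.
  rewrite ltnNge; apply: contraTN io => ni; apply: offset_last => q iq.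
  by have := ltn_ord q; lia.
apply/forall_inP => j; rewrite inE => jo; apply/negP => /eqP ji.
have [bij|bij] := eqVneq (b j) (b i).
  by move: jo; rewrite (offset_same ji bij) /= io.
by move: jo; rewrite (offset_new ji) //; apply/eqP.
Qed.

Lemma Odd_odd_offsets (p q : 'I_n.+1) : q = p.+1 :> nat ->
  (p \in Odd odd_offsets) = (b q != b p).
Proof.
move=> qp; have [bpq|bpq] /= := eqVneq (b q) (b p).
  apply/negbTE/OddP => -[_]; rewrite inE => po /(_ q); rewrite inE.
  by rewrite (offset_same qp bpq) /= po qp => /(_ isT).
have /offset_cut : b q <> b p by apply/eqP.
move=> /(_ qp) po; apply/OddP; split.
- by rewrite -qp.
- by rewrite inE.
move=> r ro rp; move: ro; rewrite (_ : r = q); last by apply: val_inj; rewrite /= rp.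
by rewrite inE (offset_new qp) //; apply/eqP.
Qed.

Lemma rank_odd_offsets (p : 'I_n.+1) : rank (Odd odd_offsets) p = b p.
Proof.
case: p => p; elim: p => [|p IH] pn.
  rewrite rank0; have -> : Ordinal pn = ord0 by apply: val_inj.
  by rewrite sorted0.
have pn' := ltnW pn; have /= rS := rankS (Odd odd_offsets) (Ordinal pn').
rewrite [rank _ _]rS [rank _ _](IH pn') (@Odd_odd_offsets _ (Ordinal pn)) //.
have := @sorted_step (Ordinal pn') (Ordinal pn) erefl.
have := @sorted_mono (Ordinal pn') (Ordinal pn) (leqnSn p).
by case: eqP => /=; lia.
Qed.

Lemma descents_odd_offsets : descents sigma \subset Odd odd_offsets.
Proof.
apply/fintype.subsetP => i; rewrite inE => /existsP[j /andP[/eqP ji sji]].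
rewrite (Odd_odd_offsets ji); apply: contraTneq sji => bji.
have := sigma_key i j; rewrite ji ltnSn /key -/(b i) -/(b j) bji ltn_add2l.
by move=> /esym /ltnW; rewrite -leqNgt.
Qed.

Lemma cut_odd_offsets : cut_blocks (Odd odd_offsets) sigma = phi.
Proof.
have nO : ord_max \notin Odd odd_offsets by apply/OddP => -[]; rewrite ltnn.
have -> : cut_blocks (Odd odd_offsets) sigma = mkseq (nth set0 phi) (size phi).
  rewrite cut_blocksE //.
  have -> : #|Odd odd_offsets|.+1 = size phi.
    rewrite -sorted_last -rank_odd_offsets; congr _.+1.
    by rewrite -rank_ord [LHS](rankS _ ord_max) (negbTE nO) addn0.
  apply/eq_in_map => k; rewrite mem_iota /= add0n => kphi.
  apply/setP => j; rewrite (block_index_eq phi_sc) //.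
  apply/imsetP/eqP => [[p]|jk].
    by rewrite inE => /eqP <- ->; rewrite rank_odd_offsets.
  by exists ((sigma^-1)%g j); rewrite ?inE ?rank_odd_offsets /b permKV ?jk.
exact: mkseq_nth.
Qed.

End OddComposition.

Lemma exists_cut n (phi : seq {set 'I_n}) :
  set_composition phi -> (forall S, S \in phi -> odd #|S|) ->
  exists Bs : {set 'I_n} * {perm 'I_n},
    [&& peak_set Bs.1, descents Bs.2 \subset Odd Bs.1
      & cut_blocks (Odd Bs.1) Bs.2 == phi].
Proof.
case: n => [|n] in phi * => phi_sc phi_odd.
  (* For n = 0 the only set composition is the empty one; the filter in [cut_blocks] discards the
     single empty block. *)
  exists (set0, 1%g) => /=; apply/and3P; split.
  - by apply/andP; split; apply/forallP => -[].
  - by apply/fintype.subsetP => -[].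
  have S0 (S : {set 'I_0}) : S = set0 by apply/setP => -[].
  have -> : phi = [::].
    case: phi {phi_odd} phi_sc => // S phi phi_sc.
    by have := sc_neq0 phi_sc (mem_head S phi); rewrite [S]S0 eqxx.
  apply/eqP; rewrite /cut_blocks (@eq_filter _ _ pred0) ?filter_pred0 // => S.
  by rewrite [S]S0 eqxx.
have [g gE] := exists_ranking (@key_inj n phi).
(* [g] gives the position of each element in the order of the keys, so its inverse lists the
   elements in that order. *)
pose sigma := (g^-1)%g.
have sE (p q : 'I_n.+1) : (p < q)%N =
    ((block_index phi (sigma p) * n.+1 + sigma p)
      < (block_index phi (sigma q) * n.+1 + sigma q))%N.
  by rewrite -gE /sigma !permKV.
exists (odd_offsets phi sigma, sigma); apply/and3P; split => /=.
- exact: peak_odd_offsets.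
- exact: descents_odd_offsets.
- by apply/eqP; apply: cut_odd_offsets.
Qed.

(** Existence of a pair rules out the default value 0, and the pair that is picked cuts into [phi],
    which determines the coefficients. *)
Lemma eta_cut n (phi : seq {set 'I_n}) :
  set_composition phi -> (forall S, S \in phi -> odd #|S|) ->
  exists B : {set 'I_n}, exists sigma : {perm 'I_n},
    [/\ peak_set B, cut_blocks (Odd B) sigma = phi & eta phi = eta_peak B sigma].
Proof.
move=> phi_sc phi_odd; rewrite /eta; case: pickP => [[B sigma]|H].
  by move=> /and3P[/= Bp _ /eqP cutE]; exists B, sigma.
by have [Bs] := exists_cut phi_sc phi_odd; rewrite H.
Qed.

Lemma eta_word n (phi : seq {set 'I_n}) (t : 'I_n -> nat) :
  set_composition phi -> (forall S, S \in phi -> odd #|S|) ->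
  eta phi (word t) =
    (-1) ^+ (n - size phi)./2 * (compat phi t)%:R * (2 ^ nvals t)%:R.
Proof.
move=> phi_sc phi_odd; have [B [sigma [Bp <- ->]]] := eta_cut phi_sc phi_odd.
exact: eta_peak_cut.
Qed.

Lemma eta_NCPi n (phi : seq {set 'I_n}) :
  set_composition phi -> (forall S, S \in phi -> odd #|S|) -> NCPi_ n (eta phi).
Proof.
move=> phi_sc phi_odd; have [B [sigma [Bp _ ->]]] := eta_cut phi_sc phi_odd.
exact: eta_peak_NCPi.
Qed.

(** * Set partitions and symmetric series *)

Section CountSorted.
Variable T : eqType.
Implicit Types (f g : T -> nat) (s : seq T).

Local Notation leqf f := (relpre f leq).

Lemma leqf_trans f : transitive (leqf f).
Proof. by move=> x y z; apply: leq_trans. Qed.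

Lemma leqf_total f : total (leqf f).
Proof. by move=> x y; apply: leq_total. Qed.

(** A sorted list is the concatenation of its level subsequences. Comparing heads suffices: both
    have the least level and come first in it. *)
Lemma sorted_filter_eq f s1 s2 :
  sorted (leqf f) s1 -> sorted (leqf f) s2 ->
  (forall c, [seq x <- s1 | f x == c] = [seq x <- s2 | f x == c]) -> s1 = s2.
Proof.
elim: s1 s2 => [|x s1 IH] [|y s2] //=.
- by move=> _ _ /(_ (f y)); rewrite eqxx.
- by move=> _ _ /(_ (f x)); rewrite eqxx.
move=> p1 p2 H.
have min1 := order_path_min (@leqf_trans f) p1.
have min2 := order_path_min (@leqf_trans f) p2.
have xy : (f x <= f y)%N.
  have : y \in [seq z <- x :: s1 | f z == f y].
    by rewrite /= H eqxx mem_head.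
  by rewrite mem_filter inE => /andP[_ /orP[/eqP->//|/(allP min1)]].
have yx : (f y <= f x)%N.
  have : x \in [seq z <- y :: s2 | f z == f x].
    by rewrite /= -H eqxx mem_head.
  by rewrite mem_filter inE => /andP[_ /orP[/eqP->//|/(allP min2)]].
have fxy : f x = f y by apply/eqP; rewrite eqn_leq xy.
have [xyE _] : x = y /\ [seq z <- s1 | f z == f x] = [seq z <- s2 | f z == f x].
  by have := H (f x); rewrite -fxy eqxx => -[].
subst y; congr (_ :: _); apply: IH; rewrite ?(path_sorted p1) ?(path_sorted p2) //.
by move=> c; have := H c; case: ifP => // _ [].
Qed.

Lemma in_sorted (e : rel T) s : {in s &, forall x y, e x y} -> sorted e s.
Proof.
move=> se; apply: pairwise_sorted; elim: s se => //= x s IH se; apply/andP; split.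
  by apply/allP => y ys; apply: se; rewrite inE ?eqxx ?ys ?orbT.
by apply: IH => y z ys zs; apply: se; rewrite inE ?ys ?zs orbT.
Qed.

(** Sorting along [g] injects the [f]-sorted orderings into the [g]-sorted ones, since an [f]-sorted
    list is recovered from its level subsequences. *)
Lemma leq_count_sorted f g s :
  uniq s -> {in s &, forall x y, (f x == f y) = (g x == g y)} ->
  (count (sorted (leqf f)) (permutations s)
    <= count (sorted (leqf g)) (permutations s))%N.
Proof.
move=> us fg; rewrite -!size_filter -(size_map (sort (leqf g))).
apply: uniq_leq_size; last first.
  move=> r' /mapP[r]; rewrite !mem_filter !mem_permutations => /andP[_ rs] ->.
  by rewrite perm_sort rs andbT; apply: sort_sorted (leqf_total g) _.
rewrite map_inj_in_uniq ?filter_uniq ?permutations_uniq // => r1 r2.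
rewrite !mem_filter !mem_permutations => /andP[s1 p1] /andP[s2 p2] r12.
(* A stable sort along g keeps the order within the common level sets of f and g. *)
have filterE r : perm_eq r s -> forall c,
    [seq x <- sort (leqf g) r | f x == c] = [seq x <- r | f x == c].
  move=> rs c; rewrite (filter_sort (@leqf_total g) (@leqf_trans g)).
  apply: sorted_sort; first exact: leqf_trans.
  apply: in_sorted => x y; rewrite !mem_filter !(perm_mem rs).
  by move=> /andP[/eqP fx xs] /andP[/eqP fy ys] /=; rewrite eq_leq //; apply/eqP;
    rewrite -fg // fx fy.
by apply: (sorted_filter_eq s1 s2) => c; rewrite -(filterE r1 p1) -(filterE r2 p2) r12.
Qed.

Lemma eq_count_sorted f g s :
  uniq s -> {in s &, forall x y, (f x == f y) = (g x == g y)} ->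
  count (sorted (leqf f)) (permutations s) = count (sorted (leqf g)) (permutations s).
Proof.
move=> us fg; apply/eqP; rewrite eqn_leq !leq_count_sorted //.
by move=> x y xs ys; rewrite fg.
Qed.

Lemma count_sorted_gt0 f s : (0 < count (sorted (leqf f)) (permutations s))%N.
Proof.
rewrite -has_count; apply/hasP; exists (sort (leqf f) s).
  by rewrite mem_permutations perm_sort.
exact: sort_sorted (leqf_total f) _.
Qed.

End CountSorted.

(** * Kernels, and orderings of the blocks of a set partition *)

Definition kernel n (t : 'I_n -> nat) : {set {set 'I_n}} :=
  [set fiber t (t j) | j : 'I_n].

Lemma eq_kernel n (t u : 'I_n -> nat) :
  kernel t = kernel u <-> forall j k, (t j == t k) = (u j == u k).
Proof.
split=> [tu j k|tu]; last first.
  by apply: eq_imset => j; apply/setP => k; rewrite !inE tu.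
suff H t' u' : kernel t' = kernel u' -> t' j = t' k -> u' j = u' k.
  by apply/eqP/eqP; apply: H.
move=> ktu tjk; have : fiber t' (t' j) \in kernel u' by rewrite -ktu imset_f.
move=> /imsetP[l _ jl]; have jE : j \in fiber u' (u' l) by rewrite -jl inE.
have : k \in fiber u' (u' l) by rewrite -jl inE tjk.
by move: jE; rewrite !inE => /eqP-> /eqP->.
Qed.

Lemma kernel_partition n (t : 'I_n -> nat) : set_partition (kernel t).
Proof.
rewrite /set_partition (_ : kernel t = preim_partition t [set: 'I_n]).
  exact: preim_partitionP.
apply/setP => S; apply/imsetP/imsetP => -[j _ ->]; exists j => //;
  by apply/setP => k; rewrite !inE /= eq_sym.
Qed.

Lemma mem_kernel n (t : 'I_n -> nat) S j :
  S \in kernel t -> j \in S -> S = fiber t (t j).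
Proof. by move=> /imsetP[k _ ->]; rewrite inE => /eqP ->. Qed.

Section Partition.
Variables (n : nat) (p : {set {set 'I_n}}).
Hypothesis p_part : set_partition p.

Lemma set_composition_enum phi : perm_eq phi (enum p) -> set_composition phi.
Proof.
move=> pphi; rewrite /set_composition (perm_uniq pphi) enum_uniq /=.
suff -> : [set:: phi] = p by [].
by apply/setP => S; rewrite inE (perm_mem pphi) mem_enum.
Qed.

Lemma compositions_overE :
  compositions_over p = [set` permutations (enum p)]%classic.
Proof.
apply/seteqP; split=> phi /=; rewrite mem_permutations.
  move=> [/sc_uniq uphi phip]; apply: uniq_perm => // [|S]; first exact: enum_uniq.
  by rewrite mem_enum -phip inE.
move=> pphi; split; first exact: set_composition_enum.
by apply/setP => S; rewrite inE (perm_mem pphi) mem_enum.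
Qed.

Lemma sum_compositions (f : seq {set 'I_n} -> series) :
  \sum_(phi \in compositions_over p) f phi =
  \sum_(phi <- permutations (enum p)) f phi.
Proof. by rewrite compositions_overE -fsbig_seq // permutations_uniq. Qed.

(** A test function with kernel [p], at which coefficients are read off. *)
Definition rep : 'I_n -> nat := block_index (enum p).

Lemma kernel_rep : kernel rep = p.
Proof.
have sc := set_composition_enum (perm_refl _).
have fE j : fiber rep (rep j) = nth set0 (enum p) (rep j).
  by apply/setP => k; rewrite (block_index_eq sc) ?inE // block_index_lt.
apply/setP => S; apply/imsetP/idP => [[j _ ->]|Sp].
  by rewrite fE -mem_enum mem_nth // block_index_lt.
have Slt : (index S (enum p) < size (enum p))%N by rewrite index_mem mem_enum.
have [j jS] := exists_block_index sc Slt; exists j => //.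
by rewrite fE /rep jS nth_index // mem_enum.
Qed.

Definition constant_on (t : 'I_n -> nat) : bool :=
  [forall S in p, [forall j in S, [forall k in S, t j == t k]]].

Lemma constant_onP t :
  reflect (forall S j k, S \in p -> j \in S -> k \in S -> t j = t k) (constant_on t).
Proof.
apply: (iffP forall_inP) => [H S j k /H /forall_inP Sj /Sj /forall_inP jk /jk /eqP //|H].
move=> S Sp; apply/forall_inP => j jS; apply/forall_inP => k kS; apply/eqP.
exact: H kS.
Qed.

(** The common value of [t] on a block; the default 0 is taken only for the empty set. *)
Definition block_val (t : 'I_n -> nat) (S : {set 'I_n}) : nat :=
  if [pick j in S] is Some j then t j else 0%N.

Lemma block_valE t S j : constant_on t -> S \in p -> j \in S -> block_val t S = t j.
Proof.
move=> /constant_onP tc Sp jS; rewrite /block_val; case: pickP => [k kS|/(_ j)].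
  exact: tc kS jS.
by rewrite jS.
Qed.

(** Turns compatibility into sortedness of a list of blocks, so that the counting of sorted
    orderings applies. *)
Lemma compat_sorted t phi : perm_eq phi (enum p) ->
  compat phi t = constant_on t && sorted (relpre (block_val t) leq) phi.
Proof.
move=> pphi; have sc := set_composition_enum pphi.
have memp k : (k < size phi)%N -> nth set0 phi k \in p.
  by move=> kphi; rewrite -mem_enum -(perm_mem pphi) mem_nth.
apply/compatP/andP => [H|[tc /(sortedP set0) ts] j k jk].
  have tc : constant_on t.
    apply/constant_onP => S j k Sp jS kS.
    have Sphi : S \in phi by rewrite (perm_mem pphi) mem_enum.
    have Slt : (index S phi < size phi)%N by rewrite index_mem.
    have bi l : l \in S -> block_index phi l = index S phi.
      by move=> lS; apply/eqP; rewrite -(block_index_eq sc) // nth_index.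
    by apply/eqP; rewrite eqn_leq !H // !bi.
  split=> //; apply/(sortedP set0) => k k1.
  have [j jk] := exists_block_index sc (ltnW k1).
  have [l lk] := exists_block_index sc k1.
  have jm := mem_block sc j; have lm := mem_block sc l; rewrite jk in jm; rewrite lk in lm.
  by rewrite /= (block_valE tc (memp _ (ltnW k1)) jm) (block_valE tc (memp _ k1) lm)
    H // jk lk.
have jm := mem_block sc j; have km := mem_block sc k.
have jl := block_index_lt sc j; have kl := block_index_lt sc k.
rewrite -(block_valE tc (memp _ jl) jm) -(block_valE tc (memp _ kl) km).
move: jk jl kl; move: (block_index phi j) (block_index phi k) => a b.
move=> {j k jm km} ab _ bl; elim: b ab bl => [|b IH]; first by rewrite leqn0 => /eqP->.
rewrite leq_eqVlt => /orP[/eqP->//|ab] bl.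
by apply: leq_trans (ts b bl); apply: IH => //; apply: ltnW.
Qed.

Definition count_compat (t : 'I_n -> nat) : nat :=
  count (fun phi => compat phi t) (permutations (enum p)).

Lemma count_compatE t :
  count_compat t = (constant_on t *
    count (sorted (relpre (block_val t) leq)) (permutations (enum p)))%N.
Proof.
rewrite /count_compat; have [tc|tc] := boolP (constant_on t).
  rewrite mul1n; apply: eq_in_count => phi; rewrite mem_permutations => /compat_sorted->.
  by rewrite tc.
rewrite mul0n; apply/eqP; rewrite -leqn0.
rewrite -[X in (_ <= X)%N](count_pred0 (permutations (enum p))).
apply: eq_leq; apply: eq_in_count => phi; rewrite mem_permutations => /compat_sorted->.
by rewrite (negbTE tc).
Qed.

Lemma count_compat_gt0 t : (0 < count_compat t)%N = constant_on t.
Proof. by rewrite count_compatE muln_gt0 lt0b count_sorted_gt0 andbT. Qed.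

(** The source of the symmetry of [nn p]: the kernel determines which block values coincide, and the
    number of sorted orderings depends on nothing else. *)
Lemma count_compat_kernel t u :
  kernel t = kernel u -> count_compat t = count_compat u.
Proof.
move=> /eq_kernel tu; rewrite !count_compatE.
have -> : constant_on t = constant_on u.
  apply: eq_forallb_in => S _; apply: eq_forallb_in => j _; apply: eq_forallb_in => k _.
  exact: tu.
have [uc|//] := boolP (constant_on u); congr (_ * _)%N.
have tc : constant_on t.
  by apply/constant_onP => S j k Sp jS kS; apply/eqP; rewrite tu; apply/eqP;
    apply: (constant_onP _ uc) kS.
apply: eq_count_sorted; first exact: enum_uniq.
move=> S S'; rewrite !mem_enum => Sp Sp'.
have neq0 Q : Q \in p -> exists j, j \in Q.
  move=> Qp; apply/set0Pn; apply: contraTneq Qp => ->.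
  by case/and3P: p_part.
have [j jS] := neq0 S Sp; have [k kS] := neq0 S' Sp'.
by rewrite !(block_valE tc Sp jS, block_valE tc Sp' kS, block_valE uc Sp jS,
  block_valE uc Sp' kS) tu.
Qed.

End Partition.

(** * Coefficients of the monomial series and characterization of NCSym *)

Lemma M_notword n (phi : seq {set 'I_n}) w :
  (forall t : 'I_n -> nat, w <> word t) -> M phi w = 0.
Proof.
move=> wt; rewrite /M (@formal_sumE _ _ _ _ [::]) // => t; split=> // -[[t0 _]].
by rewrite map_enum_word // => /esym/wt.
Qed.

(** The only tuple that can give this word is [t] shifted by one, so the coefficient is 0 or 1. *)
Lemma M_word n (phi : seq {set 'I_n}) (t : 'I_n -> nat) :
  M phi (word t) = `[<same_order (block_index phi) t>]%:R.
Proof.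
rewrite /M (@formal_sumE _ _ _ _
  (if `[<same_order (block_index phi) t>] then [:: [ffun j => (t j).+1]] else [::])).
- by case: asboolP.
- by case: asboolP.
move=> u; have uE : [seq u j | j <- enum 'I_n] = word t -> forall j, u j = (t j).+1.
  by move=> /eq_in_map ut j; apply: ut; rewrite mem_enum.
split.
  move=> [/= [u0 uphi] /uE {}uE]; case: asboolP => [_|[]].
    by rewrite inE; apply/eqP/ffunP => j; rewrite ffunE.
  move=> j k; have [_ ukj] := uphi k j; rewrite !uE ltnS in ukj.
  by rewrite leqNgt [RHS]leqNgt; congr (~~ _); apply/idP/idP => /ukj.
case: asboolP => // tphi; rewrite inE => /eqP ->; split; last first.
  by apply: eq_map => j; rewrite ffunE.
split=> [j|j k]; first by rewrite ffunE.
rewrite !ffunE; split; last by rewrite !ltnS !ltnNge tphi.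
have eqtphi := same_order_eq j k tphi.
split=> [[tjk]|bjk]; first by apply/eqP; rewrite eqtphi tjk.
by congr _.+1; apply/eqP; rewrite -eqtphi bjk.
Qed.

(** Symmetry in the variables: a coefficient depends only on which letters of the word coincide. *)
Definition kernel_invariant n (G : series) : Prop :=
  (forall w, (forall t : 'I_n -> nat, w <> word t) -> G w = 0) /\
  (forall t u : 'I_n -> nat, kernel t = kernel u -> G (word t) = G (word u)).

Section PartitionSeries.
Variables (n : nat) (p : {set {set 'I_n}}).
Hypothesis p_part : set_partition p.

Lemma m_notword w : (forall t : 'I_n -> nat, w <> word t) -> m p w = 0.
Proof.
move=> wt; rewrite /m sum_compositions // series_sumE big1 // => phi _.
exact: M_notword.
Qed.

(* When kernel t = p the count is 1, but it is enough that it is positive and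
   depends on the kernel of t only. *)
Lemma m_word t : m p (word t) = ((kernel t == p) * count_compat p t)%:R.
Proof.
rewrite /m sum_compositions // series_sumE.
have -> : ((kernel t == p) * count_compat p t)%N =
    count (fun phi => `[<same_order (block_index phi) t>]) (permutations (enum p)).
  have cE phi : perm_eq phi (enum p) ->
      `[<same_order (block_index phi) t>] = (kernel t == p) && compat phi t.
    move=> pphi; have sc := set_composition_enum p_part pphi.
    have kphi : kernel (block_index phi) = p.
      have -> : p = [set:: phi].
        by apply/setP => S; rewrite inE (perm_mem pphi) mem_enum.
      apply/setP => S; rewrite inE; apply/imsetP/idP => [[j _ ->]|Sp].
        have -> : fiber (block_index phi) (block_index phi j)
            = nth set0 phi (block_index phi j).
          by apply/setP => k; rewrite (block_index_eq sc) ?inE // block_index_lt.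
        by rewrite mem_nth // block_index_lt.
      have Slt : (index S phi < size phi)%N by rewrite index_mem.
      have [j jS] := exists_block_index sc Slt; exists j => //.
      by apply/setP => k; rewrite -(nth_index set0 Sp) (block_index_eq sc) // !inE jS.
    apply/asboolP/andP => [tphi|[/eqP kt /compatP ct] j k].
      split; last by apply/compatP => j k; rewrite tphi.
      apply/eqP; rewrite -[RHS]kphi; apply/eq_kernel => j k.
      by rewrite (same_order_eq _ _ tphi).
    apply/idP/idP; first exact: ct.
    have /eq_kernel/(_ j k) ejk := etrans kt (esym kphi).
    (* Compatibility gives weak inequalities only; equality of the kernels forbids equal values on
       distinct blocks. *)
    case: (leqP (block_index phi j) (block_index phi k)) => // kj tjk.
    by move: ejk; rewrite eqn_leq tjk ct ?(ltnW kj) // gtn_eqF.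
  rewrite /count_compat; have [kt|kt] := boolP (kernel t == p).
    rewrite mul1n; apply: eq_in_count => phi; rewrite mem_permutations => /cE->.
    by rewrite kt.
  rewrite mul0n; apply/esym/eqP; rewrite -leqn0.
  rewrite -[X in (_ <= X)%N](count_pred0 (permutations (enum p))).
  apply: eq_leq; apply: eq_in_count => phi; rewrite mem_permutations => /cE->.
  by rewrite (negbTE kt).
rewrite -sum1_count natr_sum [RHS]big_mkcond; apply: eq_bigr => phi _.
by rewrite M_word; case: asboolP.
Qed.

Lemma m_kernel_invariant : kernel_invariant n (m p).
Proof.
split=> [w|t u tu]; first exact: m_notword.
by rewrite !m_word tu (count_compat_kernel p_part tu).
Qed.

Lemma constant_on_rep : constant_on p (rep p).
Proof.
apply/constant_onP => S j k; rewrite -{1}(kernel_rep p_part) => Sp jS.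
by rewrite (mem_kernel Sp jS) inE => /eqP.
Qed.

Lemma m_rep : m p (word (rep p)) != 0.
Proof.
rewrite m_word kernel_rep // eqxx mul1n pnatr_eq0 -lt0n count_compat_gt0 //.
exact: constant_on_rep.
Qed.

End PartitionSeries.

Lemma kernel_invariantZD n a (F G : series) :
  kernel_invariant n F -> kernel_invariant n G -> kernel_invariant n (a *: F + G).
Proof.
move=> [F0 F1] [G0 G1]; split=> [w wt|t u tu]; rewrite !seriesD !seriesZ.
  by rewrite F0 // G0 // mulr0 addr0.
by rewrite (F1 _ _ tu) (G1 _ _ tu).
Qed.

Lemma NCSymP n G : NCSym_ n G <-> kernel_invariant n G.
Proof.
split.
  move=> [s [Ss ->]]; rewrite big_seq; apply: big_rec => [|q F /Ss]; first by split.
  by move=> [p /= pp <-]; apply: kernel_invariantZD; apply: m_kernel_invariant.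
move=> [G0 G1].
(* The coefficient of [m p] is read off at [rep p], where every other [m q] vanishes. *)
have -> : G = \sum_(p : {set {set 'I_n}} | set_partition p)
    (G (word (rep p)) / m p (word (rep p))) *: m p.
  apply: funext => w; rewrite series_sumE.
  have [[t ->]|wt] := pselect (exists t : 'I_n -> nat, w = word t); last first.
    have {}wt (t : 'I_n -> nat) : w <> word t by move=> wt'; apply: wt; exists t.
    by rewrite G0 // big1 // => p pp; rewrite seriesZ (m_notword pp wt) mulr0.
  have kp := kernel_partition t; have kr := kernel_rep kp.
  rewrite (bigD1 (kernel t)) //= big1 => [|p /andP[pp pt]]; last first.
    by rewrite seriesZ (m_word pp t) eq_sym (negbTE pt) mul0n mulr0.
  have [_ m1] := m_kernel_invariant kp.
  rewrite seriesZ -(m1 _ _ kr) divfK ?m_rep //.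
  by rewrite addr0; apply: G1.
apply: lin_span_sum => p _ pp; apply: lin_spanZ; apply: lin_span_gen.
by exists p.
Qed.

(** * The family n_pi *)

Section OddPartition.
Variables (n : nat) (p : {set {set 'I_n}}).
Hypothesis p_odd : odd_set_partition p.

Lemma odd_set_partitionW : set_partition p. Proof. by case/andP: p_odd. Qed.

Lemma odd_composition (phi : seq {set 'I_n}) : phi \in permutations (enum p) ->
  [/\ set_composition phi, (forall S, S \in phi -> odd #|S|) & size phi = #|p|].
Proof.
rewrite mem_permutations => pphi; split.
- exact: (set_composition_enum odd_set_partitionW pphi).
- move=> S; rewrite (perm_mem pphi) mem_enum => Sp.
  by have /andP[_ /forall_inP/(_ S Sp)] := p_odd.
- by rewrite (perm_size pphi) -cardE.
Qed.

Lemma nn_NCPi : NCPi_ n (nn p).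
Proof.
rewrite /nn sum_compositions ?odd_set_partitionW //; apply: lin_spanZ.
apply: lin_span_sum => phi /odd_composition[sc phi_odd _] _; exact: eta_NCPi.
Qed.

(** Every ordering of [p] has [#|p|] blocks, so all the [eta] terms carry the same sign, which the
    prefactor cancels. *)
Lemma nn_word t : nn p (word t) = (2 ^ nvals t * count_compat p t)%:R.
Proof.
rewrite /nn sum_compositions ?odd_set_partitionW // seriesZ series_sumE.
rewrite big_distrr /= natrM /count_compat -sum1_count natr_sum big_distrr /=.
rewrite [RHS]big_mkcond /=; apply: eq_big_seq => phi /odd_composition[sc phi_odd sz].
rewrite eta_word // sz !mulrA -exprD addnn -signr_odd odd_double expr0 mul1r.
by case: ifP => _; rewrite ?mul1r ?mulr1 ?mul0r.
Qed.

Lemma nn_kernel_invariant : kernel_invariant n (nn p).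
Proof.
split=> [w|t u tu]; first by have [G0 _ _] := NCPi_splits nn_NCPi; apply: G0.
rewrite !nn_word (count_compat_kernel odd_set_partitionW tu).
by rewrite /nvals -/(kernel t) -/(kernel u) tu.
Qed.

Lemma nn_word_neq0 t : (nn p (word t) != 0) = constant_on p t.
Proof.
rewrite nn_word pnatr_eq0 -lt0n muln_gt0 expn_gt0 /= count_compat_gt0 //.
exact: odd_set_partitionW.
Qed.

End OddPartition.

(** Here [p] refines [q], and sending a block of [p] to the block of [q] containing it is onto. If
    the cardinals agree it is also injective, so each block of [p] fills its image. *)
Lemma constant_on_card n (p q : {set {set 'I_n}}) :
  set_partition p -> set_partition q -> constant_on p (rep q) ->
  (#|q| <= #|p|)%N /\ (#|q| = #|p| -> p = q).
Proof.
move=> pp qp pc; pose f S := fiber (rep q) (block_val (rep q) S).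
have fE S j : S \in p -> j \in S -> f S = fiber (rep q) (rep q j).
  by move=> Sp jS; rewrite /f (block_valE pc Sp jS).
have kq := kernel_rep qp.
have pex j : exists2 S, S \in p & j \in S.
  have : j \in cover p by case/and3P: pp => /eqP -> _ _; rewrite inE.
  by move=> /bigcupP[S Sp jS]; exists S.
have qf : q \subset f @: p.
  rewrite -kq; apply/fintype.subsetP => _ /imsetP[j _ ->].
  by have [S Sp jS] := pex j; rewrite -(fE S j Sp jS); apply: imset_f.
have qfp := subset_leq_card qf; have fp := leq_imset_card f p.
split=> [|qpE]; first exact: leq_trans fp.
have /imset_injP finj : #|f @: p| == #|p| by rewrite eqn_leq fp -qpE.
apply/eqP; rewrite eqEcard qpE leqnn andbT; apply/fintype.subsetP => S Sp.
have /set0Pn[j jS] : S != set0.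
  by apply: contraTneq Sp => ->; case/and3P: pp.
have -> : S = f S.
  apply/setP => k; rewrite (fE S j) // inE; apply/idP/idP => [kS|/eqP kj].
    by apply/eqP; apply: (constant_onP _ _ pc) jS.
  have [S' Sp' kS'] := pex k.
  by rewrite (finj S S') // (fE S j Sp jS) (fE S' k Sp' kS') kj.
have : fiber (rep q) (rep q j) \in kernel (rep q) by apply: imset_f.
by rewrite kq (fE S j).
Qed.

(** Besides the term of [i], evaluation at [ev i] only sees terms of larger rank, whose coefficients
    vanish by downward induction on the rank. *)
Lemma triangular_lin_indep (I : choiceType) (D : set I) (b : I -> series)
    (ev : I -> seq nat) (rk : I -> nat) :
  (forall i, D i -> b i (ev i) != 0) ->
  (forall i j, D i -> D j -> b j (ev i) != 0 -> i <> j -> (rk i < rk j)%N) ->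
  lin_indep D b.
Proof.
move=> b0 btri s c us sD sum0 i si.
pose N := (\max_(j <- s) rk j)%N.
have leN j : j \in s -> (rk j <= N)%N by move=> js; rewrite /N (leq_bigmax_seq j).
have [k] := ubnP (N - rk i); elim: k i si => // k IH i si; rewrite ltnS => ik.
have := congr1 (fun f => f (ev i)) sum0; rewrite /= series_sumE.
rewrite (bigD1_seq i) //= big_seq_cond big1 ?addr0 => [|j /andP[js ji]].
  by rewrite seriesZ => /eqP; rewrite mulf_eq0 (negbTE (b0 _ (sD _ si))) orbF => /eqP.
rewrite seriesZ; apply/eqP; rewrite mulf_eq0; apply/norP => -[cj bj].
have ij : (rk i < rk j)%N by apply: btri (sD _ si) (sD _ js) bj _ => ij; rewrite ij eqxx in ji.
by move/eqP: cj; apply; apply: IH => //; have := leN j js; lia.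
Qed.

Lemma nn_triangular n (p q : {set {set 'I_n}}) :
  odd_set_partition p -> odd_set_partition q ->
  nn q (word (rep p)) != 0 -> p <> q -> (#|p| < #|q|)%N.
Proof.
move=> po qo; rewrite nn_word_neq0 // => qc pq.
have [] := constant_on_card (odd_set_partitionW qo) (odd_set_partitionW po) qc.
by rewrite leq_eqVlt => /orP[/eqP pqE /(_ pqE) /esym|].
Qed.

Lemma nn_rep n (p : {set {set 'I_n}}) :
  odd_set_partition p -> nn p (word (rep p)) != 0.
Proof. by move=> po; rewrite nn_word_neq0 // constant_on_rep // odd_set_partitionW. Qed.

Definition nn_span n : set series :=
  lin_span ((fun p : {set {set 'I_n}} => nn p) @`
    [set p : {set {set 'I_n}} | odd_set_partition p])%classic.

(** A triangular system is solved from the partitions with most blocks downwards. The number of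
    subsets serves as a bound on the number of blocks, and [k] counts the levels treated. *)
Lemma nn_interpolation n (G : series) :
  exists2 H, nn_span n H & forall p : {set {set 'I_n}}, odd_set_partition p ->
    H (word (rep p)) = G (word (rep p)).
Proof.
suff Hk k : exists2 H, nn_span n H & forall p : {set {set 'I_n}},
    odd_set_partition p -> (#|{: {set 'I_n}}| < #|p| + k)%N ->
    H (word (rep p)) = G (word (rep p)).
  have [H Hs HG] := Hk #|{: {set 'I_n}}|.+1; exists H => // p po; apply: HG => //.
  by rewrite addnS ltnS leq_addl.
elim: k => [|k [H Hs HG]].
  exists 0; first exact: lin_span0.
  by move=> p _; rewrite addn0 ltnNge max_card.
pose P (p : {set {set 'I_n}}) := odd_set_partition p && (#|{: {set 'I_n}}| == #|p| + k)%N.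
exists (H + \sum_(p | P p)
  ((G (word (rep p)) - H (word (rep p))) / nn p (word (rep p))) *: nn p).
  apply: lin_spanD => //; apply: lin_span_sum => p _ /andP[po _].
  by apply: lin_spanZ; apply: lin_span_gen; exists p.
move=> p po pk; rewrite seriesD series_sumE.
(* By triangularity, a correction at the current level changes neither the finer levels nor the
   other values at its own level. *)
have other q : P q -> q != p ->
    nn q (word (rep p)) = 0.
  move=> /andP[qo /eqP qk] qp; apply/eqP/negPn/negP => nq.
  have pq : p <> q by apply/eqP; rewrite eq_sym.
  have pq' := nn_triangular po qo nq pq.
  by move: pk; rewrite qk addnS ltnS leq_add2r leqNgt pq'.
have [pP|pP] := boolP (P p).
  rewrite (bigD1 p) //= big1 => [|q /andP[qP qp]]; last first.
    by rewrite seriesZ other ?mulr0.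
  by rewrite seriesZ divfK ?nn_rep // addr0 addrC subrK.
rewrite big1 ?addr0 => [|q qP]; last first.
  by rewrite seriesZ other ?mulr0 //; apply: contraNneq pP => <-.
apply: HG => //; move: pP pk; rewrite /P po /= addnS ltnS leq_eqVlt => /negbTE->.
by [].
Qed.

Lemma nn_span_sub n G : nn_span n G -> NCSym_ n G /\ NCPi_ n G.
Proof.
move=> Gs; split; apply: lin_span_sub Gs => _ [p /= po <-]; last exact: nn_NCPi.
by apply/NCSymP; apply: nn_kernel_invariant.
Qed.

Lemma nn_spanP n G : nn_span n G <-> NCSym_ n G /\ NCPi_ n G.
Proof.
split=> [|[Gsym Gpi]]; first exact: nn_span_sub.
have [H Hs HG] := nn_interpolation n G; have [Hsym Hpi] := nn_span_sub Hs.
suff -> : G = H by [].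
have [_ D1] := kernel_invariantZD (-1) ((NCSymP _ _).1 Hsym) ((NCSymP _ _).1 Gsym).
have Dpi : NCPi_ n (-1 *: H + G) by apply: lin_spanD => //; apply: lin_spanZ.
have D0 : forall t : 'I_n -> nat, odd_fibers t -> (-1 *: H + G) (word t) = 0.
  (* The kernel of such a [t] is an odd set partition, at whose representative [H] agrees with [G];
     kernel invariance carries this over to [t]. *)
  move=> t t_odd; have kp := kernel_partition t.
  rewrite -(D1 _ _ (kernel_rep kp)) seriesD seriesZ HG ?mulN1r ?addNr //.
  rewrite /odd_set_partition kp; apply/forall_inP => _ /imsetP[j _ ->].
  by apply: t_odd; apply/set0Pn; exists j; rewrite inE.
apply: funext => w; have := splits_eq0 (NCPi_splits Dpi) D0 w.
by rewrite seriesD seriesZ mulN1r addrC => /eqP; rewrite subr_eq0 => /eqP.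
Qed.

(** * Homogeneous components *)

Definition homog n (G : series) : series := fun w => if size w == n then G w else 0.

(** Taking the component of degree [n] is linear; it fixes the generators of degree [n] and kills
    the others. *)
Lemma homog_span (S : nat -> set series) G n :
  (forall k F, S k F -> forall w, size w != k -> F w = 0) ->
  lin_span (\bigcup_(k in [set: nat]) lin_span (S k))%classic G ->
  lin_span (S n) (homog n G).
Proof.
move=> Ssize.
have spanS k F : lin_span (S k) F -> forall w, size w != k -> F w = 0.
  move=> FS w wk; move: F FS; apply: lin_span_ind => //.
  - by move=> u v u0 v0; rewrite seriesD u0 v0 addr0.
  - by move=> a v v0; rewrite seriesZ v0 mulr0.
  - by move=> v /Ssize; apply.
apply: (lin_span_ind (P := fun F => lin_span (S n) (homog n F))).
- rewrite (_ : homog n 0 = 0); first exact: lin_span0.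
  by apply: funext => w; rewrite /homog; case: ifP.
- move=> u v Su Sv; rewrite (_ : homog n (u + v) = homog n u + homog n v).
    exact: lin_spanD.
  by apply: funext => w; rewrite /homog !seriesD; case: ifP; rewrite ?addr0.
- move=> a v Sv; rewrite (_ : homog n (a *: v) = a *: homog n v).
    exact: lin_spanZ.
  by apply: funext => w; rewrite /homog !seriesZ; case: ifP; rewrite ?mulr0.
move=> F [k _ Fk]; have [kn|kn] := eqVneq k n.
  rewrite (_ : homog n F = F) -?kn //; apply: funext => w; rewrite /homog.
  by case: eqP => // /eqP wk; rewrite (spanS _ _ Fk).
rewrite (_ : homog n F = 0); first exact: lin_span0.
apply: funext => w; rewrite /homog; case: eqP => // wn.
by rewrite (spanS _ _ Fk) // wn eq_sym.
Qed.

Lemma size_notword n (w : seq nat) :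
  size w != n -> forall t : 'I_n -> nat, w <> word t.
Proof. by move=> wn t wt; rewrite wt size_word eqxx in wn. Qed.

Lemma NCSym_homog n G : NCSym G -> NCSym_ n (homog n G).
Proof.
apply: (homog_span (S := fun k =>
  [set m p | p in [set p : {set {set 'I_k}} | set_partition p]]%classic)).
move=> k F [p /= pp <-] w wk; apply: m_notword => //.
exact: size_notword.
Qed.

Lemma NCPi_homog n G : NCPi G -> NCPi_ n (homog n G).
Proof.
apply: (homog_span (S := fun k => [set F | exists d (X : finPOrderType d)
  (gamma sigma : X -> 'I_k) (sigmaV : 'I_k -> X), [/\ bijective gamma,
  cancel sigma sigmaV, cancel sigmaV sigma & F = K gamma sigmaV]]%classic)).
move=> k F FPi w wk.
by have [F0 _ _] := NCPi_splits (lin_span_gen FPi); apply: F0; apply: size_notword.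
Qed.

(** A finite combination involves finitely many degrees, so [G] is a finite sum of homogeneous
    components. *)
Lemma NCSym_bounded G : NCSym G -> exists N, forall w, (N <= size w)%N -> G w = 0.
Proof.
apply: (lin_span_ind (P := fun G => exists N, forall w, (N <= size w)%N -> G w = 0)).
- by exists 0%N.
- move=> u v [N uN] [N' vN']; exists (maxn N N') => w; rewrite geq_max => /andP[Nw Nw'].
  by rewrite seriesD uN // vN' // addr0.
- by move=> a v [N vN]; exists N => w Nw; rewrite seriesZ vN ?mulr0.
move=> v [n _ /NCSymP[v0 _]]; exists n.+1 => w nw; apply: v0; apply: size_notword.
by rewrite neq_ltn nw orbT.
Qed.

Lemma sum_homog N G : (forall w, (N <= size w)%N -> G w = 0) ->
  G = \sum_(n < N) homog n G.
Proof.
move=> GN; apply: funext => w; rewrite series_sumE /homog.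
have [wN|/GN->] := ltnP (size w) N; last by rewrite big1 // => n _; case: ifP.
rewrite (bigD1 (Ordinal wN)) //= eqxx big1 ?addr0 // => n.
by rewrite -val_eqE /= eq_sym => /negbTE->.
Qed.

Theorem theorem10p5 :
  (forall n : nat,
     is_basis [set p : {set {set 'I_n}} | odd_set_partition p]%classic
              (fun p : {set {set 'I_n}} => nn p)
              (NCSym_ n `&` NCPi_ n)%classic)
  /\
  is_basis [set q : {n : nat & {set {set 'I_n}}} |
              odd_set_partition (projT2 q)]%classic
           (fun q : {n : nat & {set {set 'I_n}}} => nn (projT2 q))
           (NCSym `&` NCPi)%classic.
Proof.
split=> [n|]; split.
- apply: (triangular_lin_indep (ev := fun p => word (rep p)) (rk := fun p => #|p|)).
    by move=> p; apply: nn_rep.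
  by move=> p q; apply: nn_triangular.
- by apply/seteqP; split=> G /nn_spanP.
- apply: (triangular_lin_indep
    (ev := fun q : {n : nat & {set {set 'I_n}}} => word (rep (projT2 q)))
    (rk := fun q : {n : nat & {set {set 'I_n}}} => #|projT2 q|)).
    by move=> q; apply: nn_rep.
  move=> [n p] [k q] /= po qo nz pq.
  (* In different degrees the coefficient is 0, since the word has the wrong length. *)
  have nk : n = k.
    apply/eqP; apply: contraNT nz => nk; apply/eqP.
    have [q0 _] := nn_kernel_invariant qo; apply: q0; apply: size_notword.
    by rewrite size_word.
  by subst k; apply: nn_triangular => //; apply: contra_not pq => ->.
apply/seteqP; split=> G.
  apply: lin_span_ind.
  - by split; apply: lin_span0.
  - by move=> u v [? ?] [? ?]; split; apply: lin_spanD.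
  - by move=> a v [? ?]; split; apply: lin_spanZ.
  move=> _ [[n p] /= po <-]; split; apply: lin_span_gen; exists n => //.
    by apply/NCSymP; apply: nn_kernel_invariant.
  exact: nn_NCPi.
(* Each homogeneous component lies in both spaces of its degree, so the fixed-degree result applies
   to it. *)
move=> [Gsym Gpi]; have [N GN] := NCSym_bounded Gsym; rewrite (sum_homog GN).
apply: lin_span_sum => n _ _.
have : nn_span n (homog n G).
  by apply/nn_spanP; split; [apply: NCSym_homog | apply: NCPi_homog].
apply: lin_span_sub => _ [p po <-]; apply: lin_span_gen.
by exists (existT (fun n => {set {set 'I_n}}) (n : nat) p).
Qed.
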